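(* Let $n\ge 1$ be a natural number. There exists a true $\Pi_{2n}$ sentence $\varphi$ of first-order arithmetic such that for any computable $\mathsf{PA}$-verifiable linear order $\mathcal L$ of order-type at most $\omega^n$ (i.e. $\mathcal L$ is well-ordered with order-type an ordinal $\le\omega^n$), $$\mathsf{RFN}^{\mathcal L}(\mathsf{PA})\nvdash\varphi .$$
   Context: $\mathsf{PA}$ is first-order Peano arithmetic; ''true'' means true in the standard model $\mathbb N$. Computable linear orders. A linear order $\mathcal L$ is a set $L\subseteq\mathbb N$ with a binary relation $\preceq^{\mathcal L}$ (coded as a set of numbers via a standard pairing function) satisfying the axioms of (non-strict) linear orders; $L=\{x: x\preceq^{\mathcal L}x\}$. Inside first-order arithmetic a computable linear order is represented by a natural number coding a pair consisting of an index of a $\Pi_1$-set and an index of a $\Sigma_1$-set which define the same set $\preceq^{\mathcal L}$, this set being a linear order. $\mathsf{LO}(\mathcal L)$ is the first-order arithmetical formula expressing that $\mathcal L$ is a computable linear order in this sense. $\mathcal L$ is $\mathsf{PA}$-verifiable if $\mathsf{PA}\vdash\mathsf{LO}(\mathcal L)$. Uniform reflection. Let $T$ be a c.e. axiomatizable arithmetical theory given by a $\Sigma_1$-formula $\mathsf{Ax}_T(x)$ saying that $x$ is the Gödel number of an axiom of $T$, and let $\mathsf{Prv}_T(x)$ be the natural provability predicate (there is a first-order proof of $x$ from premises satisfying $\mathsf{Ax}_T$). $\mathsf{RFN}(T)$ is the extension of $T$ by all sentences $\forall x\,(\mathsf{Prv}_T(\ulcorner\varphi(\dot x)\urcorner)\to\varphi(x))$,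 for $\varphi(x)$ an arbitrary arithmetical formula ($\dot x$ denotes substitution of the numeral of $x$). Iteration. For a $\mathsf{PA}$-verifiable computable linear order $\mathcal L$ and $a\in L$, $$\mathsf{RFN}^{(\mathcal L,a)}(T)=T+\bigcup_{b\prec^{\mathcal L}a}\mathsf{RFN}(\mathsf{RFN}^{(\mathcal L,b)}(T)),\qquad \mathsf{RFN}^{\mathcal L}(T)=T+\bigcup_{a\in L}\mathsf{RFN}(\mathsf{RFN}^{(\mathcal L,a)}(T)).$$ Formally, the axioms of $\mathsf{RFN}^{(\mathcal L,a)}(T)$ are recognized by the $\Sigma_1$-formula $\mathsf{Ax}_T^{\mathcal L}(\underline a,y)$, where $\mathsf{Ax}_T^{\mathcal L}(x,y)$ is obtained by the Diagonal Lemma so as to be $\mathsf{PA}$-provably equivalent to: ''$x\in\mathcal L$, and either $y$ is an axiom of $T$ or for some $z\prec^{\mathcal L}x$, $y$ is an instance of the uniform reflection scheme for the theory whose axioms are defined by $\mathsf{Ax}_T^{\mathcal L}(\underline z,\cdot)$''. *)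

(* Defs.v *)
From mathcomp Require Import all_boot all_order.

Set Implicit Arguments.
Unset Strict Implicit.
Unset Printing Implicit Defensive.

(** * First-order arithmetic *)

(* Variables are named by natural numbers. *)
Inductive term : Type :=
  | Var of nat
  | Zero
  | Succ of term
  | Add of term & term
  | Mul of term & term.

Inductive form : Type :=
  | Bot
  | All of nat & form
  | Eq of term & term
  | Le of term & term
  | Imp of form & form.

Definition Neg (A : form) : form := Imp A Bot.
Definition And (A B : form) : form := Neg (Imp A (Neg B)).
Definition Or (A B : form) : form := Imp (Neg A) B.
Definition Iff (A B : form) : form := And (Imp A B) (Imp B A).
Definition Ex (x : nat) (A : form) : form := Neg (All x (Neg A)).

Definition num (n : nat) : term := iter n Succ Zero.

Fixpoint free_t (x : nat) (t : term) : bool :=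
  match t with
  | Var n => n == x
  | Zero => false
  | Succ s => free_t x s
  | Add s u | Mul s u => free_t x s || free_t x u
  end.

Fixpoint free (x : nat) (A : form) : bool :=
  match A with
  | Bot => false
  | All n B => (n != x) && free x B
  | Eq s u | Le s u => free_t x s || free_t x u
  | Imp B C => free x B || free x C
  end.

Definition sentence (A : form) : Prop := forall x, ~~ free x A.

Fixpoint subst_t (x : nat) (t s : term) : term :=
  match s with
  | Var n => if n == x then t else Var n
  | Zero => Zero
  | Succ u => Succ (subst_t x t u)
  | Add u v => Add (subst_t x t u) (subst_t x t v)
  | Mul u v => Mul (subst_t x t u) (subst_t x t v)
  end.

Fixpoint subst (x : nat) (t : term) (A : form) : form :=
  match A with
  | Bot => Bot
  | All n B => if n == x then All n B else All n (subst x t B)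
  | Eq u v => Eq (subst_t x t u) (subst_t x t v)
  | Le u v => Le (subst_t x t u) (subst_t x t v)
  | Imp B C => Imp (subst x t B) (subst x t C)
  end.

(* [subst] does not rename bound variables: this says that it captures none. *)
Fixpoint substitutable (x : nat) (t : term) (A : form) : bool :=
  match A with
  | Bot | Eq _ _ | Le _ _ => true
  | All n B =>
      (n == x) || (~~ free_t n t || ~~ free x B) && substitutable x t B
  | Imp B C => substitutable x t B && substitutable x t C
  end.

(** ** Truth in the standard model *)

Definition upd (rho : nat -> nat) (x n : nat) : nat -> nat :=
  fun y => if y == x then n else rho y.

Fixpoint eval (rho : nat -> nat) (t : term) : nat :=
  match t with
  | Var n => rho n
  | Zero => 0
  | Succ s => (eval rho s).+1
  | Add s u => eval rho s + eval rho u
  | Mul s u => eval rho s * eval rho u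
  end.

Fixpoint sat (rho : nat -> nat) (A : form) : Prop :=
  match A with
  | Bot => False
  | All x B => forall n, sat (upd rho x n) B
  | Eq s u => eval rho s = eval rho u
  | Le s u => eval rho s <= eval rho u
  | Imp B C => sat rho B -> sat rho C
  end.

Definition true_in_N (A : form) : Prop := forall rho, sat rho A.

(** ** Arithmetical hierarchy *)

(* Bounded existential quantifiers are covered by [D0_imp] and [D0_bot]. *)
Inductive Delta0 : form -> Prop :=
  | D0_bot : Delta0 Bot
  | D0_eq s t : Delta0 (Eq s t)
  | D0_le s t : Delta0 (Le s t)
  | D0_imp A B : Delta0 A -> Delta0 B -> Delta0 (Imp A B)
  | D0_ball x t A :
      ~~ free_t x t -> Delta0 A -> Delta0 (All x (Imp (Le (Var x) t) A)).

Inductive Sigma : nat -> form -> Prop :=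
  | Sigma_0 A : Delta0 A -> Sigma 0 A
  | Sigma_Pi n A : Pi n A -> Sigma n.+1 A
  | Sigma_ex n x A : Sigma n.+1 A -> Sigma n.+1 (Ex x A)
with Pi : nat -> form -> Prop :=
  | Pi_0 A : Delta0 A -> Pi 0 A
  | Pi_Sigma n A : Sigma n A -> Pi n.+1 A
  | Pi_all n x A : Pi n.+1 A -> Pi n.+1 (All x A).

(** ** Derivability *)

Definition theory := form -> Prop.

Inductive logical_axiom : form -> Prop :=
  | LA_K A B : logical_axiom (Imp A (Imp B A))
  | LA_S A B C :
      logical_axiom
        (Imp (Imp A (Imp B C)) (Imp (Imp A B) (Imp A C)))
  | LA_DN A : logical_axiom (Imp (Neg (Neg A)) A)
  | LA_inst x t A :
      substitutable x t A -> logical_axiom (Imp (All x A) (subst x t A))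
  | LA_dist x A B :
      ~~ free x A ->
      logical_axiom (Imp (All x (Imp A B)) (Imp A (All x B)))
  | LA_refl t : logical_axiom (Eq t t)
  | LA_leibniz x s t A :
      substitutable x s A -> substitutable x t A ->
      logical_axiom (Imp (Eq s t) (Imp (subst x s A) (subst x t A))).

Inductive prv (T : theory) : form -> Prop :=
  | prv_ax A : T A -> prv T A
  | prv_log A : logical_axiom A -> prv T A
  | prv_mp A B : prv T A -> prv T (Imp A B) -> prv T B
  | prv_gen x A : prv T A -> prv T (All x A).

(** ** Peano arithmetic *)

Definition PA_basic : seq form :=
  let x := Var 0 in let y := Var 1 in let z := Var 2 in
  [:: All 0 (Neg (Eq (Succ x) Zero));
      All 0 (All 1 (Imp (Eq (Succ x) (Succ y)) (Eq x y)));
      All 0 (Eq (Add x Zero) x);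
      All 0 (All 1 (Eq (Add x (Succ y)) (Succ (Add x y))));
      All 0 (Eq (Mul x Zero) Zero);
      All 0 (All 1 (Eq (Mul x (Succ y)) (Add (Mul x y) x)));
      All 0 (All 1 (Iff (Le x y) (Ex 2 (Eq (Add x z) y))))].

Definition induction_axiom (x : nat) (A : form) : form :=
  Imp (subst x Zero A)
    (Imp (All x (Imp A (subst x (Succ (Var x)) A))) (All x A)).

(* Induction instances keep their parameters free; by [prv_gen] this is the
   same theory as the one with their universal closures. *)
Inductive PA : theory :=
  | PA_basic_axiom i : i < size PA_basic -> PA (nth Bot PA_basic i)
  | PA_induction x A : PA (induction_axiom x A).

(** * Goedel numbering *)

Definition pair_code (x y : nat) : nat := ((x + y) * (x + y).+1)./2 + y.

Fixpoint code_t (t : term) : nat :=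
  match t with
  | Var n => pair_code 0 n
  | Zero => pair_code 1 0
  | Succ s => pair_code 2 (code_t s)
  | Add s u => pair_code 5 (pair_code (code_t s) (code_t u))
  | Mul s u => pair_code 6 (pair_code (code_t s) (code_t u))
  end.

Fixpoint code (A : form) : nat :=
  match A with
  | Bot => pair_code 3 0
  | All n B => pair_code 4 (pair_code n (code B))
  | Eq s u => pair_code 7 (pair_code (code_t s) (code_t u))
  | Le s u => pair_code 8 (pair_code (code_t s) (code_t u))
  | Imp B C => pair_code 9 (pair_code (code B) (code C))
  end.

(** * Writing arithmetical formulas *)

(* An [fm] is a formula waiting for a number [d] such that every variable of
   the terms it mentions is among v_0, ..., v_(d-1).  A quantifier takes v_d as
   its bound variable, so that no capture can occur. *)
Definition fm := nat -> form.

Definition feq (s t : term) : fm := fun _ => Eq s t.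
Definition fle (s t : term) : fm := fun _ => Le s t.
Definition fimp (A B : fm) : fm := fun d => Imp (A d) (B d).
Definition fneg (A : fm) : fm := fun d => Neg (A d).
Definition fand (A B : fm) : fm := fun d => And (A d) (B d).
Definition for_ (A B : fm) : fm := fun d => Or (A d) (B d).
Definition fiff (A B : fm) : fm := fun d => Iff (A d) (B d).
Definition fall (A : term -> fm) : fm := fun d => All d (A (Var d) d.+1).
Definition fex (A : term -> fm) : fm := fun d => Ex d (A (Var d) d.+1).

Declare Scope fm_scope.
Delimit Scope fm_scope with F.
Bind Scope fm_scope with fm.
Notation "s = t" := (feq s t) : fm_scope.
Notation "s <> t" := (fneg (feq s t)) : fm_scope.
Notation "s <= t" := (fle s t) : fm_scope.
Notation "s < t" := (fle (Succ s) t) : fm_scope.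
Notation "A ===> B" := (fimp A B) (at level 90, right associativity) : fm_scope.
Notation "A /\ B" := (fand A B) : fm_scope.
Notation "A \/ B" := (for_ A B) : fm_scope.
Notation "~ A" := (fneg A) : fm_scope.
Notation "A <-> B" := (fiff A B) : fm_scope.
Notation "'EX' x .. y , A" := (fex (fun x => .. (fex (fun y => A)) ..))
  (at level 200, x binder, y binder, right associativity) : fm_scope.
Notation "'AL' x .. y , A" := (fall (fun x => .. (fall (fun y => A)) ..))
  (at level 200, x binder, y binder, right associativity) : fm_scope.
Notation "'ALB' x '<=' t , A" := (fall (fun x => fimp (fle x t) A))
  (at level 200, x name, t at level 69, right associativity) : fm_scope.

Local Open Scope fm_scope.

Definition is_pair (a b z : term) : fm :=
  Add z z = Add (Mul (Add a b) (Succ (Add a b))) (Add b b).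

(* Expressions for numbers built from terms by iterated pairing;
   [y =: e] is the formula saying that [y] is the value of [e]. *)
Inductive cexp : Type :=
  | CTerm of term
  | CPair of cexp & cexp.
Coercion CTerm : term >-> cexp.

Fixpoint equals (e : cexp) (y : term) : fm :=
  match e with
  | CTerm t => y = t
  | CPair a b => EX u v, equals a u /\ equals b v /\ is_pair u v y
  end.

Notation "y =: e" := (equals e y) (at level 70, e at next level) : fm_scope.
Notation "<< a , b >>" := (CPair a b) (at level 0) : fm_scope.
Notation "<< a , b , c >>" := (CPair a (CPair b c)) (at level 0) : fm_scope.

Definition c_op (k : term) (a b : cexp) : cexp := CPair k (CPair a b).
Definition c_Var (n : cexp) : cexp := CPair (num 0) n.
Definition c_Zero : cexp := CPair (num 1) (num 0).
Definition c_Succ (a : cexp) : cexp := CPair (num 2) a.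
Definition c_Bot : cexp := CPair (num 3) (num 0).
Definition c_All (n a : cexp) : cexp := c_op (num 4) n a.
Definition c_Eq (a b : cexp) : cexp := c_op (num 7) a b.
Definition c_Imp (a b : cexp) : cexp := c_op (num 9) a b.
Definition c_Neg (a : cexp) : cexp := c_Imp a c_Bot.

(* Goedel's beta function: y is the remainder of c modulo 1 + (i + 1) d. *)
Definition beta (c d i y : term) : fm :=
  EX q, c = Add (Mul q (Succ (Mul (Succ i) d))) y /\ y <= Mul (Succ i) d.

(* [inductively R e]: the value of [e] is the last entry of a finite sequence
   each entry [y] of which satisfies [R P y], where [P e'] says that the value
   of [e'] is an earlier entry.  As all rules [R] below are positive in [P], this
   defines the least set closed under [R].  Apart from [LO], all formulas below
   are built from literals by conjunction, disjunction, bounded universal and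
   unbounded existential quantification, hence are Sigma_1 up to PA-provable
   equivalence. *)
Definition inductively (R : (cexp -> fm) -> term -> fm) (e : cexp) : fm :=
  EX c d l x, x =: e /\ beta c d l x /\
    ALB i <= l, EX y, beta c d i y /\
      R (fun e' => EX z j, z =: e' /\ j < i /\ beta c d j z) y.

(** ** Arithmetized syntax *)

Definition is_term (t : term) : fm :=
  inductively (fun P y =>
    (EX n, y =: c_Var n) \/ y =: c_Zero \/
    (EX a, y =: c_Succ a /\ P a) \/
    (EX k a b, num 5 <= k /\ k <= num 6 /\ y =: c_op k a b /\ P a /\ P b)) t.

Definition is_form (f : term) : fm :=
  inductively (fun P y =>
    y =: c_Bot \/
    (EX x a, y =: c_All x a /\ P a) \/
    (EX k s t, num 7 <= k /\ k <= num 8 /\ y =: c_op k s t /\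
       is_term s /\ is_term t) \/
    (EX a b, y =: c_Imp a b /\ P a /\ P b)) f.

(* v_x is not free in the term or formula e *)
Definition is_fresh (x e : term) : fm :=
  inductively (fun P y =>
    (EX n, n <> x /\ y =: c_Var n) \/ y =: c_Zero \/ y =: c_Bot \/
    (EX a, y =: c_Succ a /\ P a) \/
    (EX n a, y =: c_All n a /\ (n = x \/ P a)) \/
    (EX k a b, num 5 <= k /\ k <= num 9 /\ y =: c_op k a b /\ P a /\ P b)) e.

(* e' is the result of substituting the term t for v_x in the term or formula e,
   and no variable of t gets captured *)
Definition is_subst (x t e e' : term) : fm :=
  inductively (fun P y => EX a b, y =: <<a, b>> /\
    ((a =: c_Var x /\ b = t) \/
     (EX n, n <> x /\ a =: c_Var n /\ b = a) \/
     ((a =: c_Zero \/ a =: c_Bot) /\ b = a) \/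
     (EX u u', a =: c_Succ u /\ b =: c_Succ u' /\ P <<u, u'>>) \/
     (EX n u, a =: c_All n u /\
        ((n = x /\ b = a) \/
         (EX u', n <> x /\ (is_fresh n t \/ is_fresh x u) /\
            b =: c_All n u' /\ P <<u, u'>>))) \/
     (EX k u v u' v', num 5 <= k /\ k <= num 9 /\
        a =: c_op k u v /\ b =: c_op k u' v' /\ P <<u, u'>> /\ P <<v, v'>>)))
  <<e, e'>>.

(* c is the code of the numeral of n *)
Definition is_num (n c : term) : fm :=
  inductively (fun P y =>
    y =: <<num 0, c_Zero>> \/
    (EX m u, y =: <<Succ m, c_Succ u>> /\ P <<m, u>>)) <<n, c>>.

Definition is_logical_axiom (y : term) : fm :=
  (EX a b, is_form a /\ is_form b /\ y =: c_Imp a (c_Imp b a)) \/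
  (EX a b c, is_form a /\ is_form b /\ is_form c /\
     y =: c_Imp (c_Imp a (c_Imp b c)) (c_Imp (c_Imp a b) (c_Imp a c))) \/
  (EX a, is_form a /\ y =: c_Imp (c_Neg (c_Neg a)) a) \/
  (EX x t a b, is_term t /\ is_form a /\ is_subst x t a b /\
     y =: c_Imp (c_All x a) b) \/
  (EX x a b, is_form a /\ is_form b /\ is_fresh x a /\
     y =: c_Imp (c_All x (c_Imp a b)) (c_Imp a (c_All x b))) \/
  (EX t, is_term t /\ y =: c_Eq t t) \/
  (EX x s t a b c, is_term s /\ is_term t /\ is_form a /\
     is_subst x s a b /\ is_subst x t a c /\
     y =: c_Imp (c_Eq s t) (c_Imp b c)).

Definition is_PA_axiom (y : term) : fm :=
  foldr (fun A F => y = num (code A) \/ F)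
    (EX x a zero succ b c, is_form a /\
       zero =: c_Zero /\ is_subst x zero a b /\
       succ =: c_Succ (c_Var x) /\ is_subst x succ a c /\
       y =: c_Imp b (c_Imp (c_All x (c_Imp a c)) (c_All x a)))
    PA_basic.

(* A theory is presented by the formula [ax] defining its axioms. *)
Definition Prv (ax : term -> fm) (f : term) : fm :=
  inductively (fun P y =>
    is_logical_axiom y \/ (is_form y /\ ax y) \/
    (EX a, P a /\ P (c_Imp a y)) \/
    (EX x a, y =: c_All x a /\ P a)) f.

Definition axioms_of (ax : term -> fm) : theory :=
  fun A => true_in_N (ax (num (code A)) 0).

(** * Computable linear orders *)

(* The partial recursive function with index e maps x to v. The indices are
     <0,_> : x |-> 0                  <4,<f,g>> : x |-> <f(x), g(x)>
     <1,_> : x |-> x + 1              <5,<f,g>> : x |-> f(g(x))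
     <2,_> : <a,b> |-> a              <6,<f,g>> : primitive recursion
     <3,_> : <a,b> |-> b              <7,f> : x |-> least v with f(<x,v>) = 0
   where h = <6,<f,g>> is given by h(<a,0>) = f(a) and
   h(<a,m+1>) = g(<<a,m>, h(<a,m>)>). *)
Definition computes (e x v : term) : fm :=
  inductively (fun P y => EX e x v, y =: <<e, x, v>> /\
    ((EX p, e =: <<num 0, p>> /\ v = Zero) \/
     (EX p, e =: <<num 1, p>> /\ v = Succ x) \/
     (EX p b, e =: <<num 2, p>> /\ x =: <<v, b>>) \/
     (EX p a, e =: <<num 3, p>> /\ x =: <<a, v>>) \/
     (EX f g a b, e =: <<num 4, f, g>> /\
        P <<f, x, a>> /\ P <<g, x, b>> /\ v =: <<a, b>>) \/
     (EX f g a, e =: <<num 5, f, g>> /\ P <<g, x, a>> /\ P <<f, a, v>>) \/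
     (EX f g a, e =: <<num 6, f, g>> /\ x =: <<a, Zero>> /\ P <<f, a, v>>) \/
     (EX f g a m w, e =: <<num 6, f, g>> /\ x =: <<a, Succ m>> /\
        P <<e, <<a, m>>, w>> /\ P <<g, <<<<a, m>>, w>>, v>>) \/
     (EX f, e =: <<num 7, f>> /\ P <<f, <<x, v>>, Zero>> /\
        ALB i <= v, i = v \/ EX w, P <<f, <<x, i>>, Succ w>>)))
  <<e, x, v>>.

(* The Sigma_1 set with index e; the Pi_1 set with index e is its complement. *)
Definition in_W (e x : term) : fm := EX v, computes e x v.

Definition le_Sigma (l x y : term) : fm :=
  EX p s z, l =: <<p, s>> /\ z =: <<x, y>> /\ in_W s z.

Definition lt_Sigma (l x y : term) : fm := le_Sigma l x y /\ x <> y.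

Definition dom_Sigma (l x : term) : fm := le_Sigma l x x.

Definition LO (l : term) : fm :=
  (EX p s, l =: <<p, s>> /\ AL z, ~ in_W p z <-> in_W s z) /\
  (AL x y, le_Sigma l x y ===> dom_Sigma l x /\ dom_Sigma l y) /\
  (AL x y, le_Sigma l x y /\ le_Sigma l y x ===> x = y) /\
  (AL x y z, le_Sigma l x y /\ le_Sigma l y z ===> le_Sigma l x z) /\
  (AL x y, dom_Sigma l x /\ dom_Sigma l y ===> le_Sigma l x y \/ le_Sigma l y x).

Definition PA_verifiable (L : nat) : Prop := prv PA (LO (num L) 0).

Definition order_le (L x y : nat) : Prop :=
  true_in_N (le_Sigma (num L) (num x) (num y) 0).

Definition order_dom (L x : nat) : Prop := order_le L x x.

(* [n.-tuplelexi nat] is N^n with the lexicographic order, of type omega^n. *)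
Definition order_type_le_omega_pow (L n : nat) : Prop :=
  (exists f : nat -> n.-tuplelexi nat,
     (forall x y, order_dom L x -> order_dom L y ->
        (order_le L x y <-> (f x <= f y)%O)) /\
     (forall x s, order_dom L x -> (s <= f x)%O ->
        exists y, order_dom L y /\ f y = s))%type.

(** * Uniform reflection and its iteration *)

(* Prv_ax of the result of substituting in f the numeral of v for v_0 *)
Definition Prv_dot (ax : term -> fm) (f v : term) : fm :=
  EX c w, is_num v c /\ is_subst (num 0) c f w /\ Prv ax w.

(* The bound variables of the premise are chosen from v_4 on, leaving
   v_1, v_2, v_3 for the parameters of [diag_form]. *)
Definition reflection_instance (ax : term -> fm) (A : form) : form :=
  All 0 (Imp (Prv_dot ax (num (code A)) (Var 0) 4) A).

Definition RFN (ax : term -> fm) : theory := fun B =>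
  (axioms_of ax B \/
   exists A, (forall x, free x A -> x = 0) /\ B = reflection_instance ax A)%type.

(* y codes "forall v_0 (h -> A)", where A is a formula without free variables
   other than v_0 and h is g with the numerals of z and of the code of A
   substituted for v_2 and v_1.  (The index of a variable occurring in A is
   bounded by the code of A.) *)
Definition is_reflection_instance (g z y : term) : fm :=
  EX a nz na g' h,
    is_form a /\ (ALB x <= a, x = Zero \/ is_fresh x a) /\
    is_num z nz /\ is_subst (num 2) nz g g' /\
    is_num a na /\ is_subst (num 1) na g' h /\
    y =: c_All (num 0) (c_Imp h a).

(* When u codes a formula with free variables v_0, ..., v_3, the premise of the
   reflection instances is obtained from its diagonalization. *)
Definition Ax_step (L : nat) (axT : term -> fm) (u x y : term) : fm :=
  dom_Sigma (num L) x /\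
  (axT y \/
   EX z nu g, lt_Sigma (num L) z x /\
     is_num u nu /\ is_subst (num 3) nu u g /\ is_reflection_instance g z y).

Definition diag_form (L : nat) (axT : term -> fm) : form :=
  Prv_dot (Ax_step L axT (Var 3) (Var 2)) (Var 1) (Var 0) 4.

(* The fixed point: substituting the numerals of [code (diag_form L axT)], z and
   [code A] for v_3, v_2, v_1 in [diag_form L axT] yields the premise of
   [reflection_instance (Ax_iter L axT (num z)) A].  Hence [Ax_iter L axT x y] says
   that x is in L and that y is an axiom of T or, for some z below x, an instance
   of reflection for the theory defined by [Ax_iter L axT (num z)]. *)
Definition Ax_iter (L : nat) (axT : term -> fm) (x y : term) : fm :=
  Ax_step L axT (num (code (diag_form L axT))) x y.

Definition RFN_below (L a : nat) (axT : term -> fm) : theory :=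
  axioms_of (Ax_iter L axT (num a)).

Definition RFN_along (L : nat) (axT : term -> fm) : theory := fun B =>
  (axioms_of axT B \/
   exists a, order_dom L a /\ RFN (Ax_iter L axT (num a)) B)%type.

(* Main.v *)
Require Import Defs.
From mathcomp Require Import all_boot all_order.
From mathcomp Require Import zify.
From Stdlib Require Import Classical FunctionalExtensionality.

(** The sentence comes from Tarski's diagonal argument, applied to a Sigma_2n set S
    of codes of sentences which contains only true sentences and contains every
    theorem of RFN^L(PA), for all the orders L in question at once.  Given such an S,
    let phi say that phi is not in S.  If phi were in S it would be true, hence not
    in S; so phi is not in S, therefore true and unprovable, and it is Pi_2n because
    S is Sigma_2n.

    The set S.  A proof in RFN^L(PA) uses finitely many axioms, so it is a proof from
    PA and reflection for the theories of index at most some element a of L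
    ([prv_RFN_along]).  As L has order type at most omega^n, the elements up to a form
    an order of type below omega^n.  So let S consist of the sentences provable from
    PA and reflection for the theories of index at most a, for some code L of an order
    that PA proves linear and some a such that the elements up to a have order type
    below omega^n.

    S contains only true sentences.  The reflection axioms for a theory with true
    axioms are true, and the order below a is well-founded, so by induction all the
    theories of index at most a are sound ([iter_axiom_true], [upto_axiom_true]).  This
    uses that the arithmetized provability predicate means provability.

    S is Sigma_2n.  Having order type below omega^n is expressed by [near], a formula
    with n alternations of the form `there is b such that for all z': an interval has
    type below omega^(m+1) iff finitely many, hence numerically bounded, elements w are
    such that each element z of the interval lies in some interval [w,z] of type below
    omega^m ([near_of_type], [near_acc]).  Provability is Sigma_1.  Since L varies, the
    code of the formula that defines the iteration along L has to be computed from L: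
    this formula results from a single one by substituting the numeral of L
    ([diag_uniform]).

    The arithmetical formulas are families of formulas indexed by terms and by the next
    unused variable.  Two facts about such families are proved once for all of those
    that occur, by induction on the inductive predicate [unif]: they commute with the
    substitution of terms ([unif_subst]), and a family of Sigma_1 shape expresses a
    Sigma_1 relation between the values of the terms ([unif_Sem]).  What a particular family means is
    determined compositionally by the rules for [Sem]. *)

Set Implicit Arguments.
Unset Strict Implicit.
Unset Printing Implicit Defensive.

Local Notation env := (nat -> nat).

(** * Truth and derivability *)

Lemma eval_ext rho rho' t :
  (forall x, free_t x t -> rho x = rho' x) -> eval rho t = eval rho' t.
Proof.
elim: t => [n|//|s IH|s IHs u IHu|s IHs u IHu] /= H; first by apply: H.
- by rewrite IH.
- by rewrite IHs ?IHu // => x Hx; apply: H; rewrite Hx ?orbT.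
- by rewrite IHs ?IHu // => x Hx; apply: H; rewrite Hx ?orbT.
Qed.

Lemma sat_ext A rho rho' :
  (forall x, free x A -> rho x = rho' x) -> sat rho A <-> sat rho' A.
Proof.
elim: A rho rho' => [|y B IH|s u|s u|B IHB C IHC] rho rho' H //=.
- have E n : sat (upd rho y n) B <-> sat (upd rho' y n) B.
    apply: IH => x Hx; rewrite /upd; case: eqP => // /eqP Hxy.
    by apply: H; rewrite /= Hx eq_sym Hxy.
  by split=> K n; apply/E.
- by rewrite (@eval_ext rho rho' s) ?(@eval_ext rho rho' u) // => x Hx;
    apply: H; rewrite /= Hx ?orbT.
- by rewrite (@eval_ext rho rho' s) ?(@eval_ext rho rho' u) // => x Hx;
    apply: H; rewrite /= Hx ?orbT.
- rewrite (IHB rho rho') ?(IHC rho rho') // => x Hx;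
    apply: H; by rewrite /= Hx ?orbT.
Qed.

Lemma eval_num rho n : eval rho (num n) = n.
Proof. by elim: n => //= n ->. Qed.

Lemma free_num x n : free_t x (num n) = false.
Proof. by elim: n. Qed.

Lemma eval_subst_t rho x t s :
  eval rho (subst_t x t s) = eval (upd rho x (eval rho t)) s.
Proof.
elim: s => [n|//|s IH|s IHs u IHu|s IHs u IHu] /=; rewrite ?IH ?IHs ?IHu //.
by rewrite /upd; case: eqP.
Qed.

Lemma upd_same rho x n m : upd (upd rho x n) x m = upd rho x m.
Proof. by apply: functional_extensionality => y; rewrite /upd; case: eqP. Qed.

Lemma upd_swap rho x y n m :
  x != y -> upd (upd rho x n) y m = upd (upd rho y m) x n.
Proof.
move=> /eqP Hxy; apply: functional_extensionality => z; rewrite /upd.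
by case: eqP => // ->; case: eqP => // E; case: Hxy.
Qed.

Lemma eval_upd rho x n t : ~~ free_t x t -> eval (upd rho x n) t = eval rho t.
Proof.
move=> Hx; apply: eval_ext => y Hy; rewrite /upd; case: eqP => // E.
by move: Hy; rewrite E (negPf Hx).
Qed.

Lemma sat_upd rho x n A : ~~ free x A -> sat (upd rho x n) A <-> sat rho A.
Proof.
move=> Hx; apply: sat_ext => y Hy; rewrite /upd; case: eqP => // E.
by move: Hy; rewrite E (negPf Hx).
Qed.

Lemma sat_subst A rho x t : substitutable x t A ->
  sat rho (subst x t A) <-> sat (upd rho x (eval rho t)) A.
Proof.
elim: A rho => [|y B IH|s u|s u|B IHB C IHC] rho /=; rewrite ?eval_subst_t //.
- have [-> _ /=|Hyx /= /andP[Hcap Hs]] := eqVneq y x.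
    by split=> H n; move: (H n); rewrite upd_same.
  have E n : sat (upd rho y n) (subst x t B) <->
             sat (upd (upd rho x (eval rho t)) y n) B.
    rewrite IH // (@upd_swap rho x y); last by rewrite eq_sym.
    case Hf: (free x B) Hcap; rewrite ?orbF => Hcap; first by rewrite eval_upd.
    by rewrite !(@sat_upd _ x) ?Hf.
  by split=> H n; apply/E.
- by move=> /andP[HB HC]; rewrite IHB ?IHC.
Qed.

Lemma logical_axiom_true A rho : logical_axiom A -> sat rho A.
Proof.
case=> /= {A}; try by [].
- by move=> A B C H1 H2 H; apply: H1 => //; apply: H2.
- by move=> A; apply: NNPP.
- by move=> x t A Hs H; apply/sat_subst.
- by move=> x A B Hx H HA n; apply: H; apply/sat_upd.
- by move=> x s t A Hs Ht E /(sat_subst _ Hs) H; apply/(sat_subst _ Ht); rewrite -E.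
Qed.

Lemma prv_true (T : theory) A :
  (forall B, T B -> true_in_N B) -> prv T A -> true_in_N A.
Proof.
move=> HT; elim=> {A} [A /HT //|A HA rho|A B _ HA _ HB rho|x A _ HA rho n].
- exact: logical_axiom_true.
- exact: (HB rho (HA rho)).
- exact: HA.
Qed.

Lemma prv_weaken (T U : theory) A :
  (forall B, T B -> U B) -> prv T A -> prv U A.
Proof.
move=> H; elim=> {A} [A HA|A HA|A B _ HA _ HB|x A _ HA].
- by apply: prv_ax; apply: H.
- exact: prv_log.
- exact: prv_mp HA HB.
- exact: prv_gen.
Qed.

Lemma substitutable_closed x t A :
  (forall y, ~~ free_t y t) -> substitutable x t A.
Proof.
by move=> Ht; elim: A => //= [y B ->|B -> C ->//]; rewrite Ht orbT.
Qed.

Lemma substitutable_num x n A : substitutable x (num n) A.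
Proof. by apply: substitutable_closed => y; rewrite free_num. Qed.

Lemma sat_subst_num rho x n A : sat rho (subst x (num n) A) <-> sat (upd rho x n) A.
Proof. by rewrite sat_subst ?eval_num //; apply: substitutable_num. Qed.

(** The only binder that could capture x is one of x itself, and it stops the
    substitution. *)
Lemma substitutable_succ x A : substitutable x (Succ (Var x)) A.
Proof.
by elim: A => //= [y B ->|B -> C ->//]; rewrite andbT (eq_sym x); case: eqP.
Qed.

Lemma PA_true A : PA A -> true_in_N A.
Proof.
case=> [i Hi|x {}A] rho.
  case: i Hi => [|[|[|[|[|[|[|//]]]]]]] _; rewrite /nth /PA_basic.
  - by move=> n.
  - by move=> n m /= [].
  - by move=> n /=; rewrite addn0.
  - by move=> n m /=; rewrite addnS.
  - by move=> n /=; rewrite muln0.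
  - by move=> n m /=; rewrite mulnS addnC.
  - move=> n m /=; rewrite /upd /=; apply.
      by move=> H K; apply: (K (m - n)); lia.
    by move=> H; apply: NNPP => K; apply: H => k E; apply: K; lia.
rewrite /induction_axiom /= => H0 HS n.
elim: n => [|n IH].
  by move/(sat_subst _ (substitutable_num x 0 A)): H0.
move: (HS n IH) => /(sat_subst _ (substitutable_succ x A)).
by rewrite upd_same /= {2}/upd eqxx.
Qed.

(** * The arithmetical hierarchy of predicates *)

(** Simultaneous capture-avoiding substitution: when the terms substituted mention only
    variables below K, the bound variables can be renamed to v_K, v_(K+1) and so on. *)
Fixpoint msub_t (s : nat -> term) (t : term) : term :=
  match t with
  | Var n => s n
  | Zero => Zero
  | Succ u => Succ (msub_t s u)
  | Add u v => Add (msub_t s u) (msub_t s v)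
  | Mul u v => Mul (msub_t s u) (msub_t s v)
  end.

Definition bind (s : nat -> term) (x K : nat) : nat -> term :=
  fun y => if y == x then Var K else s y.

Fixpoint msub (s : nat -> term) (K : nat) (A : form) : form :=
  match A with
  | Bot => Bot
  | All x B => All K (msub (bind s x K) K.+1 B)
  | Eq u v => Eq (msub_t s u) (msub_t s v)
  | Le u v => Le (msub_t s u) (msub_t s v)
  | Imp B C => Imp (msub s K B) (msub s K C)
  end.

Definition below (K : nat) (t : term) : Prop := forall x, free_t x t -> x < K.

Lemma below_leq K K' t : K <= K' -> below K t -> below K' t.
Proof. by move=> H Ht x /Ht; lia. Qed.

Lemma below_bind s x K :
  (forall i, below K (s i)) -> forall i, below K.+1 (bind s x K i).
Proof.
move=> Hs i; rewrite /bind; case: eqP => _.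
  by move=> y /= /eqP ->.
by apply: below_leq (Hs i).
Qed.

Lemma eval_msub_t rho s t : eval rho (msub_t s t) = eval (fun i => eval rho (s i)) t.
Proof. by elim: t => //= [t ->|t -> u ->|t -> u ->]. Qed.

Lemma sat_msub A rho s K : (forall i, below K (s i)) ->
  sat rho (msub s K A) <-> sat (fun i => eval rho (s i)) A.
Proof.
elim: A rho s K => [|x B IH|t u|t u|B IHB C IHC] rho s K Hs //=;
  rewrite ?eval_msub_t //; last by rewrite IHB ?IHC.
have E n : sat (upd rho K n) (msub (bind s x K) K.+1 B) <->
           sat (upd (fun i => eval rho (s i)) x n) B.
  rewrite IH; last exact: below_bind.
  apply: sat_ext => y _; rewrite /bind [RHS]/upd; case: eqP => _ /=.
    by rewrite /upd eqxx.
  by apply: eval_upd; apply/negP => /Hs; lia.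
by split=> H n; apply/E.
Qed.

Lemma free_msub_t s t x : free_t x (msub_t s t) -> exists i, free_t x (s i).
Proof.
elim: t => //= [n|t IHt u IHu|t IHt u IHu]; first by exists n.
- by move=> /orP[/IHt|/IHu].
- by move=> /orP[/IHt|/IHu].
Qed.

Lemma free_msub A s K x : free x (msub s K A) -> exists i, free_t x (s i).
Proof.
elim: A s K => [|y B IH|t u|t u|B IHB C IHC] s K //=.
- move=> /andP[Hx /IH [i]]; rewrite /bind; case: eqP => _ /=; last by exists i.
  by rewrite (negPf Hx).
- by move=> /orP[/free_msub_t|/free_msub_t].
- by move=> /orP[/free_msub_t|/free_msub_t].
- by move=> /orP[/IHB|/IHC].
Qed.

Lemma msub_bind s x K t : ~~ free_t x t -> msub_t (bind s x K) t = msub_t s t.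
Proof.
by elim: t => //= [n|t IH H|t IHt u IHu|t IHt u IHu];
  rewrite ?negb_or; [rewrite /bind => /negPf ->|rewrite IH
  |move=> /andP[H H']; rewrite IHt ?IHu..].
Qed.

Lemma Delta0_msub A s K : (forall i, below K (s i)) -> Delta0 A -> Delta0 (msub s K A).
Proof.
move=> Hs HA; elim: HA s K Hs => {A} /=.
- by move=> *; apply: D0_bot.
- by move=> *; apply: D0_eq.
- by move=> *; apply: D0_le.
- by move=> A B _ IHA _ IHB s K Hs; apply: D0_imp; [apply: IHA|apply: IHB].
- move=> x t A Hx _ IH s K Hs; rewrite msub_bind // {1}/bind eqxx.
  apply: D0_ball; last by apply: IH; apply: below_bind.
  by apply/negP => /free_msub_t [i /Hs]; rewrite ltnn.
Qed.

Scheme Sigma_mind := Induction for Sigma Sort Prop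
  with Pi_mind := Induction for Pi Sort Prop.
Combined Scheme Sigma_Pi_ind from Sigma_mind, Pi_mind.

Lemma Sigma_Pi_msub :
  (forall m A, Sigma m A -> forall s K, (forall i, below K (s i)) -> Sigma m (msub s K A))
  /\ (forall m A, Pi m A -> forall s K, (forall i, below K (s i)) -> Pi m (msub s K A)).
Proof.
apply: Sigma_Pi_ind => [A HA s K Hs|m A _ IH s K Hs|m x A _ IH s K Hs
                       |A HA s K Hs|m A _ IH s K Hs|m x A _ IH s K Hs].
- by apply: Sigma_0; apply: Delta0_msub.
- by apply: Sigma_Pi; apply: IH.
- by apply: Sigma_ex; apply: IH; apply: below_bind.
- by apply: Pi_0; apply: Delta0_msub.
- by apply: Pi_Sigma; apply: IH.
- by apply: Pi_all; apply: IH; apply: below_bind.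
Qed.

Lemma Delta0_subst x n A : Delta0 A -> Delta0 (subst x (num n) A).
Proof.
elim=> {A} /= [|s t|s t|A B _ IHA _ IHB|y t A Hy HA IH].
- exact: D0_bot.
- exact: D0_eq.
- exact: D0_le.
- exact: D0_imp.
- case: eqP => _ /=; first exact: D0_ball.
  apply: D0_ball => //; elim: t Hy {HA IH} => //= [z|s IHs u IHu|s IHs u IHu].
  + by case: (z == x); rewrite /= ?free_num.
  + by rewrite !negb_or => /andP[/IHs -> /IHu ->].
  + by rewrite !negb_or => /andP[/IHs -> /IHu ->].
Qed.

Lemma Sigma_Pi_subst x n :
  (forall m A, Sigma m A -> Sigma m (subst x (num n) A))
  /\ (forall m A, Pi m A -> Pi m (subst x (num n) A)).
Proof.
apply: Sigma_Pi_ind => [A HA|m A _ IH|m y A HA IH|A HA|m A _ IH|m y A HA IH] /=.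
- by apply: Sigma_0; apply: Delta0_subst.
- exact: Sigma_Pi.
- by case: eqP => _ /=; [apply: (Sigma_ex y HA)|apply: (Sigma_ex y IH)].
- by apply: Pi_0; apply: Delta0_subst.
- exact: Pi_Sigma.
- by case: eqP => _ /=; [apply: (Pi_all y HA)|apply: (Pi_all y IH)].
Qed.

Lemma Sigma_Pi_neg :
  (forall m A, Sigma m A ->
     exists2 B, Pi m B & forall rho, sat rho B <-> ~ sat rho A)
  /\ (forall m A, Pi m A ->
     exists2 B, Sigma m B & forall rho, sat rho B <-> ~ sat rho A).
Proof.
apply: Sigma_Pi_ind => [A HA|m A _ [B HB E]|m x A _ [B HB E]|A HA|m A _ [B HB E]|m x A _ [B HB E]].
- by exists (Neg A) => //; apply/Pi_0/D0_imp => //; apply: D0_bot.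
- by exists B => //; apply: Pi_Sigma.
- exists (All x B) => [|rho /=]; first exact: Pi_all.
  split=> [H K|H n]; first by apply: K => n; apply/E.
  by apply/E => K; apply: H => H'; apply: (H' n).
- by exists (Neg A) => //; apply/Sigma_0/D0_imp => //; apply: D0_bot.
- by exists B => //; apply: Sigma_Pi.
- exists (Ex x B) => [|rho /=]; first exact: Sigma_ex.
  split=> H K; apply: H => n; first by move=> /E; apply.
  by apply: NNPP => H'; apply: (K n); apply/E.
Qed.

Definition scons (n : nat) (rho : env) : env := fun i => if i is j.+1 then rho j else n.

Lemma free_bounded_t t : exists N, below N t.
Proof.
elim: t => [n||t IH|t [N HN] u [M HM]|t [N HN] u [M HM]] /=.
- by exists n.+1 => x /= /eqP ->.
- by exists 0.
- by [].
- by exists (N + M) => x /= /orP[/HN|/HM]; lia.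
- by exists (N + M) => x /= /orP[/HN|/HM]; lia.
Qed.

Lemma free_bounded A : exists N, forall x, free x A -> x < N.
Proof.
elim: A => [|y B [N HN]|t u|t u|B [N HN] C [M HM]] /=.
- by exists 0.
- by exists N => x /andP[_ /HN].
- have [N HN] := free_bounded_t t; have [M HM] := free_bounded_t u.
  by exists (N + M) => x /orP[/HN|/HM]; lia.
- have [N HN] := free_bounded_t t; have [M HM] := free_bounded_t u.
  by exists (N + M) => x /orP[/HN|/HM]; lia.
- by exists (N + M) => x /orP[/HN|/HM]; lia.
Qed.

Lemma below_family (s : nat -> term) N : exists K, forall i, i < N -> below K (s i).
Proof.
elim: N => [|N [K HK]]; first by exists 0.
have [M HM] := free_bounded_t (s N); exists (K + M) => i.
rewrite ltnS leq_eqVlt => /orP[/eqP ->|/HK]; apply: below_leq; [|exact: HM|]; lia.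
Qed.

(** Makes the variables of all terms substituted bounded, at no cost: only finitely many
    variables are free in a given formula. *)
Definition cut (N : nat) (s : nat -> term) : nat -> term :=
  fun i => if i < N then s i else Zero.

Lemma below_cut N K s : (forall i, i < N -> below K (s i)) -> forall i, below K (cut N s i).
Proof. by move=> H i; rewrite /cut; case: ifP => // /H. Qed.

Lemma sat_msub_cut A N K s rho :
  (forall x, free x A -> x < N) -> (forall i, i < N -> below K (s i)) ->
  sat rho (msub (cut N s) K A) <-> sat (fun i => eval rho (s i)) A.
Proof.
move=> HN HK; rewrite sat_msub; last exact: below_cut.
by apply: sat_ext => x /HN Hx; rewrite /cut Hx.
Qed.

(** Predicates of environments are read in the de Bruijn manner: a quantifier binds
    index 0 and shifts the others.  Closure properties can then be stated for predicates,
    and the renaming of variables in formulas is confined to a few lemmas. *)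
Definition D0 (P : env -> Prop) : Prop :=
  exists2 A, Delta0 A & forall rho, sat rho A <-> P rho.

Lemma D0_iff P Q : (forall rho, P rho <-> Q rho) -> D0 P -> D0 Q.
Proof. by move=> E [A HA H]; exists A => // rho; rewrite H. Qed.

Lemma D0_subst P s : D0 P -> D0 (fun rho => P (fun i => eval rho (s i))).
Proof.
case=> A HA E; have [N HN] := free_bounded A; have [K HK] := below_family s N.
exists (msub (cut N s) K A) => [|rho].
  by apply: Delta0_msub => //; apply: below_cut.
by rewrite sat_msub_cut.
Qed.

Lemma D0_eq_term s t : D0 (fun rho => eval rho s = eval rho t).
Proof. by exists (Eq s t); first exact: D0_eq. Qed.

Lemma D0_le_term s t : D0 (fun rho => eval rho s <= eval rho t).
Proof. by exists (Le s t); first exact: D0_le. Qed.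

Lemma D0_not P : D0 P -> D0 (fun rho => ~ P rho).
Proof.
case=> A HA E; exists (Neg A) => [|rho /=]; last by rewrite E.
by apply: Defs.D0_imp => //; apply: D0_bot.
Qed.

Lemma D0_or P Q : D0 P -> D0 Q -> D0 (fun rho => P rho \/ Q rho).
Proof.
case=> A HA EA [B HB EB]; exists (Or A B) => [|rho /=].
  by do !apply: Defs.D0_imp => //; apply: D0_bot.
rewrite EA EB; split=> [H|[]//]; by case: (classic (P rho)) => ?; [left|right; apply: H].
Qed.

Lemma D0_and P Q : D0 P -> D0 Q -> D0 (fun rho => P rho /\ Q rho).
Proof.
move=> HP HQ; apply: D0_iff (D0_not (D0_or (D0_not HP) (D0_not HQ))) => rho.
split=> [H|[HP' HQ'] []//].
by split; apply: NNPP => K; apply: H; [left|right].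
Qed.

Lemma D0_ball_pred (P : nat -> env -> Prop) t :
  D0 (fun rho => P (rho 0) (fun i => rho i.+1)) ->
  D0 (fun rho => forall n, n <= eval rho t -> P n rho).
Proof.
case=> A HA E; have [N HN] := free_bounded A; have [M HM] := free_bounded_t t.
pose K := N + M; pose s i := if i is j.+1 then Var j else Var K.
have Hs i : i < N -> below K.+1 (s i).
  by case: i => [|i] Hi x /= /eqP <-; rewrite /K; lia.
exists (All K (Imp (Le (Var K) t) (msub (cut N s) K.+1 A))) => [|rho /=].
  apply: D0_ball; first by apply/negP => /HM; rewrite /K; lia.
  by apply: Delta0_msub => //; apply: below_cut.
have Et n : eval (upd rho K n) t = eval rho t.
  by apply: eval_upd; apply/negP => /HM; rewrite /K; lia.
have EP n : sat (upd rho K n) (msub (cut N s) K.+1 A) <-> P n rho.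
  rewrite sat_msub_cut // -(E (scons n rho)).
  apply: sat_ext => -[|x] /HN Hx /=; rewrite /upd ?eqxx //.
  by case: eqP => // Exk; move: Hx; rewrite Exk /K; lia.
split=> H n; move: (H n); rewrite Et EP {1}/upd eqxx; exact.
Qed.

Lemma D0_bex_pred (P : nat -> env -> Prop) t :
  D0 (fun rho => P (rho 0) (fun i => rho i.+1)) ->
  D0 (fun rho => exists n, n <= eval rho t /\ P n rho).
Proof.
move=> HP; have := D0_not (@D0_ball_pred (fun n rho => ~ P n rho) t (D0_not HP)).
apply: D0_iff => rho; split=> [H|[n [Hn HP']] H]; last exact: H HP'.
by apply: NNPP => K; apply: H => n Hn HP'; apply: K; exists n.
Qed.

(** The Sigma_m predicates of environments; the Pi_m predicates are represented as those
    whose negation is Sigma_m. *)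
Inductive Sg : nat -> (env -> Prop) -> Prop :=
  | Sg_D0 P : D0 P -> Sg 0 P
  | Sg_not m P : Sg m (fun rho => ~ P rho) -> Sg m.+1 P
  | Sg_ex m (P : nat -> env -> Prop) :
      Sg m.+1 (fun rho => P (rho 0) (fun i => rho i.+1)) ->
      Sg m.+1 (fun rho => exists n, P n rho)
  | Sg_iff m P Q : (forall rho, P rho <-> Q rho) -> Sg m P -> Sg m Q.

Lemma not_notE (A : Prop) : ~ ~ A <-> A.
Proof. by split; [apply: NNPP|move=> H K; apply: K]. Qed.

Lemma Sg_subst m P s : Sg m P -> Sg m (fun rho => P (fun i => eval rho (s i))).
Proof.
move=> H; elim: H s => {m P} [P HP|m P _ IH|m P _ IH|m P Q E _ IH] s.
- by apply: Sg_D0; apply: D0_subst.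
- by apply: Sg_not; apply: IH.
- pose s' i := if i is j.+1 then msub_t (fun k => Var k.+1) (s j) else Var 0.
  apply: (@Sg_ex m (fun n rho => P n (fun i => eval rho (s i)))).
  apply: Sg_iff (IH s') => rho /=.
  suff -> : (fun i => eval rho (msub_t (fun k => Var k.+1) (s i))) =
            (fun i => eval (fun i0 => rho i0.+1) (s i)) by [].
  by apply: functional_extensionality => i; rewrite eval_msub_t.
- by apply: Sg_iff (IH s) => rho; apply: E.
Qed.

Lemma Sg_ren m P (r : nat -> nat) : Sg m P -> Sg m (fun rho => P (fun i => rho (r i))).
Proof. exact: (@Sg_subst m P (fun i => Var (r i))). Qed.

Lemma Sg0_D0 P : Sg 0 P -> D0 P.
Proof.
move E: 0 => m H; elim: H E => // {m P} [m P Q EPQ _ IH] E.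
by apply: D0_iff EPQ (IH E).
Qed.

(** The closure of Sigma_m under one connective needs the closure of its dual class under
    the other one, hence both are treated at once. *)
Definition conn (b : bool) (P Q : Prop) : Prop := if b then P /\ Q else P \/ Q.

Lemma conn_not b P Q : conn (~~ b) (~ P) (~ Q) <-> ~ conn b P Q.
Proof.
case: b => /=; split=> [[]H //|H].
- by case.
- by case.
- by case: (classic P) => HP; [right=> HQ; apply: H|left].
- by move=> K [].
- by split=> K; apply: H; [left|right].
Qed.

Lemma conn_ex b (P : nat -> Prop) Q : (exists n, conn b (P n) Q) <-> conn b (exists n, P n) Q.
Proof.
case: b => /=; split.
- by case=> n [HP HQ]; split=> //; exists n.
- by case=> -[n HP] HQ; exists n.
- by case=> n [HP|HQ]; [left; exists n|right].
- by case=> [[n HP]|HQ]; [exists n; left|exists 0; right].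
Qed.

Lemma conn_sym b P Q : conn b P Q <-> conn b Q P.
Proof. by case: b; split=> /= -[]; tauto. Qed.

Lemma conn_iff b P P' Q Q' : (P <-> P') -> (Q <-> Q') -> conn b P Q <-> conn b P' Q'.
Proof. by case: b => /=; tauto. Qed.

Lemma Sg_conn m b P Q : Sg m P -> Sg m Q -> Sg m (fun rho => conn b (P rho) (Q rho)).
Proof.
elim: m b P Q => [|m IHm] b P Q.
  move=> /Sg0_D0 HP /Sg0_D0 HQ; apply: Sg_D0.
  by case: b; [apply: D0_and|apply: D0_or].
have base P1 Q1 : Sg m (fun rho => ~ P1 rho) -> Sg m.+1 Q1 ->
    Sg m.+1 (fun rho => conn b (Q1 rho) (P1 rho)).
  move=> + HQ; move Ek: m.+1 HQ => k HQ.
  elim: HQ P1 Ek => {k Q1} [//|k Q1 HQ _|k Q1 HQ IH|k Q1 Q2 E _ IH] P1 [Ek] HP1; subst k.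
  - apply: Sg_not; apply: Sg_iff (IHm (~~ b) _ _ HQ HP1) => rho; exact: conn_not.
  - have := IH (fun rho => P1 (fun i => rho i.+1)) erefl (Sg_ren succn HP1).
    move=> /(@Sg_ex m (fun n rho => conn b (Q1 n rho) (P1 rho))).
    by apply: Sg_iff => rho; apply: conn_ex.
  - by apply: Sg_iff (IH P1 _ HP1) => // rho; apply: conn_iff.
move=> HP; move Ek: m.+1 HP => k HP.
elim: HP Q Ek => {k P} [//|k P HP _|k P HP IH|k P P' E _ IH] Q [Ek] HQ; subst k.
- by apply: Sg_iff (base _ _ HP HQ) => rho; apply: conn_sym.
- have := IH (fun rho => Q (fun i => rho i.+1)) erefl (Sg_ren succn HQ).
  move=> /(@Sg_ex m (fun n rho => conn b (P n rho) (Q rho))).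
  by apply: Sg_iff => rho; apply: conn_ex.
- by apply: Sg_iff (IH Q _ HQ) => // rho; apply: conn_iff.
Qed.

Lemma Sg_and m P Q : Sg m P -> Sg m Q -> Sg m (fun rho => P rho /\ Q rho).
Proof. exact: (@Sg_conn m true). Qed.

Lemma Sg_or m P Q : Sg m P -> Sg m Q -> Sg m (fun rho => P rho \/ Q rho).
Proof. exact: (@Sg_conn m false). Qed.

Lemma Sg_cumul m P : Sg m P -> Sg m.+1 P /\ Sg m.+1 (fun rho => ~ P rho).
Proof.
elim=> {m P} [P HP|m P _ [IH1 IH2]|m P H [IH1 _]|m P Q E _ [IH1 IH2]].
- by split; apply: Sg_not; apply: Sg_D0; do !apply: D0_not.
- split; apply: Sg_not => //.
- split; first exact: Sg_ex.
  apply: Sg_not; apply: (@Sg_iff _ (fun rho => exists n, P n rho)).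
    by move=> rho; rewrite not_notE.
  exact: Sg_ex.
- by split; [apply: Sg_iff IH1|apply: Sg_iff IH2 => rho; rewrite E].
Qed.

Lemma Sg_leq m k P : m <= k -> Sg m P -> Sg k P.
Proof.
move=> /subnK <-; elim: (k - m) => // i IH H.
by have [] := Sg_cumul (IH H).
Qed.

Lemma Sg_all m (P : nat -> env -> Prop) :
  Sg m.+1 (fun rho => ~ P (rho 0) (fun i => rho i.+1)) ->
  Sg m.+2 (fun rho => forall n, P n rho).
Proof.
move=> /(@Sg_ex m (fun n rho => ~ P n rho)) H; apply: Sg_not; apply: Sg_iff H => rho; split.
  by case=> n H K; apply: H.
by move=> H; apply: NNPP => K; apply: H => n; apply: NNPP => L; apply: K; exists n.
Qed.

Lemma Sg1_atom P : D0 P -> Sg 1 P.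
Proof. by move=> HP; apply: (Sg_leq (leq0n 1)); apply: Sg_D0. Qed.

(** Two existential quantifiers collapse to one, which bounds both witnesses. *)
Lemma Sg1_D0 P : Sg 1 P ->
  exists Q : nat -> env -> Prop,
    D0 (fun rho => Q (rho 0) (fun i => rho i.+1)) /\
    forall rho, P rho <-> exists n, Q n rho.
Proof.
move E: 1 => m H; elim: H E => {m P} [//|m P HP _|m P _ IH|m P P' E _ IH] [Em]; subst.
- move/Sg0_D0: HP => /D0_not HP.
  exists (fun _ => P); split.
    apply: D0_iff (D0_subst (fun i => Var i.+1) HP) => rho /=.
    by rewrite not_notE.
  by move=> rho; split=> [H|[]//]; exists 0.
- have [Q [HQ E]] := IH erefl.
  exists (fun b rho => exists n, n <= b /\ exists k, k <= b /\ Q k (scons n rho)); split.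
    apply: (@D0_bex_pred (fun n rho => exists k, k <= rho 0 /\
      Q k (scons n (fun i => rho i.+1))) (Var 0)).
    apply: (@D0_bex_pred (fun k rho =>
      Q k (scons (rho 0) (fun i => rho i.+2))) (Var 1)).
    apply: D0_iff (D0_subst (fun i => match i with
      0 => Var 0 | 1 => Var 1 | j.+2 => Var j.+3 end) HQ) => rho /=.
    suff -> : (fun i => eval rho match i with 0 => Var 1 | i1.+1 => Var i1.+3 end) =
              scons (rho 1) (fun i => rho i.+3) by [].
    by apply: functional_extensionality => -[].
  move=> rho; split=> [[n]|[b [n [_ [k [_ H]]]]]].
    move=> H; have [k Hk] := (E (scons n rho)).1 H.
    by exists (n + k), n; split; [lia|exists k; split; [lia|]].
  by exists n; apply: (E (scons n rho)).2; exists k.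
- have [Q [HQ E']] := IH erefl; exists Q; split=> // rho.
  by rewrite -E.
Qed.

(** Collection: the finitely many witnesses have a common bound. *)
Lemma Sg1_ball (P : nat -> env -> Prop) t :
  Sg 1 (fun rho => P (rho 0) (fun i => rho i.+1)) ->
  Sg 1 (fun rho => forall n, n <= eval rho t -> P n rho).
Proof.
case/Sg1_D0 => Q [HQ E].
pose R b rho := forall n, n <= eval rho t -> exists k, k <= b /\ Q k (scons n rho).
apply: (@Sg_iff _ (fun rho => exists b, R b rho)).
  move=> rho; split=> [[b Hb] n /Hb [k [_ H]]|H].
    by apply: (E (scons n rho)).2; exists k.
  suff [b Hb] : exists b, forall n, n < (eval rho t).+1 -> exists k, k <= b /\ Q k (scons n rho).
    by exists b.
  have H' n : n < (eval rho t).+1 -> exists k, Q k (scons n rho).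
    by rewrite ltnS => /H Hn; apply/(E (scons n rho)).
  elim: (eval rho t).+1 H' => [|N IH] H'; first by exists 0.
  have [|b Hb] := IH; first by move=> n Hn; apply: H'; lia.
  have [k Hk] := H' N (ltnSn N).
  exists (b + k) => n; rewrite ltnS leq_eqVlt => /orP[/eqP ->|/Hb [k' [Hk' HQ']]].
    by exists k; split=> //; lia.
  by exists k'; split=> //; lia.
apply: Sg_ex; apply: Sg_not; apply: Sg_D0; apply: D0_not; rewrite /R.
apply: (@D0_iff (fun rho => forall n, n <= eval rho (msub_t (fun i => Var i.+1) t) ->
   exists k, k <= rho 0 /\ Q k (scons n (fun i => rho i.+1)))).
  by move=> rho; rewrite eval_msub_t.
apply: (@D0_ball_pred (fun n rho => exists k, k <= rho 0 /\ Q k (scons n (fun i => rho i.+1)))).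
apply: (@D0_bex_pred (fun k rho => Q k (scons (rho 0) (fun i => rho i.+2))) (Var 1)).
apply: D0_iff (D0_subst (fun i => match i with
      0 => Var 0 | 1 => Var 1 | j.+2 => Var j.+3 end) HQ) => rho /=.
suff -> : (fun i => eval rho match i with 0 => Var 1 | i1.+1 => Var i1.+3 end) =
          scons (rho 1) (fun i => rho i.+3) by [].
by apply: functional_extensionality => -[].
Qed.

Lemma Sg_Sigma m P : Sg m P -> exists2 A, Sigma m A & forall rho, sat rho A <-> P rho.
Proof.
elim=> {m P} [P [A HA E]|m P _ [A HA E]|m P _ [A HA E]|m P Q EPQ _ [A HA E]].
- by exists A => //; apply: Sigma_0.
- have [B HB E'] := Sigma_Pi_neg.1 _ _ HA.
  exists B; first exact: Sigma_Pi.
  by move=> rho; rewrite E' E not_notE.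
- have [N HN] := free_bounded A.
  pose s i := if i is j.+1 then Var j else Var N.
  have Hs i : i < N -> below N.+1 (s i).
    by case: i => [|i] Hi x /= /eqP <-; lia.
  exists (Ex N (msub (cut N s) N.+1 A)) => [|rho].
    by apply: Sigma_ex; apply: Sigma_Pi_msub.1 => //; apply: below_cut.
  have EP n : sat (upd rho N n) (msub (cut N s) N.+1 A) <-> P n rho.
    rewrite sat_msub_cut // -(E (scons n rho)).
    apply: sat_ext => -[|x] /HN Hx /=; rewrite /upd ?eqxx //.
    by case: eqP => // Exk; move: Hx; rewrite Exk; lia.
  rewrite /=; split=> [H|[n Hn] H].
    by apply: NNPP => K; apply: H => n /EP Hn; apply: K; exists n.
  by apply: (H n); apply/EP.
- by exists A => // rho; rewrite E.
Qed.
(** * Uniform families of formulas *)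

Inductive utm : ((nat -> term) -> term) -> Prop :=
  | utm_var i : utm (fun e => e i)
  | utm_zero : utm (fun _ => Zero)
  | utm_succ s : utm s -> utm (fun e => Succ (s e))
  | utm_add s t : utm s -> utm t -> utm (fun e => Add (s e) (t e))
  | utm_mul s t : utm s -> utm t -> utm (fun e => Mul (s e) (t e)).

Lemma utm_num n : utm (fun _ => num n).
Proof. by elim: n => [|n IH]; [apply: utm_zero|apply: utm_succ]. Qed.

(** Families of formulas, indexed by an environment of terms, that are built in the same
    way whatever these terms are.  Stating this by closure rules replaces an induction on
    formulas, which is impossible as the formulas are functions of the depth at which they
    are placed.  When [b] is true the family is of Sigma_1 shape. *)
Inductive unif (b : bool) : ((nat -> term) -> fm) -> Prop :=
  | u_eq s t : utm s -> utm t -> unif b (fun e => feq (s e) (t e))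
  | u_le s t : utm s -> utm t -> unif b (fun e => fle (s e) (t e))
  | u_neq s t : utm s -> utm t -> unif b (fun e => fneg (feq (s e) (t e)))
  | u_and F G : unif b F -> unif b G -> unif b (fun e => fand (F e) (G e))
  | u_or F G : unif b F -> unif b G -> unif b (fun e => for_ (F e) (G e))
  | u_ex F : unif b (fun e => F (e 0) (fun i => e i.+1)) ->
      unif b (fun e => fex (fun x => F x e))
  | u_ball t F : utm t -> unif b (fun e => F (e 0) (fun i => e i.+1)) ->
      unif b (fun e => fall (fun x => fimp (fle x (t e)) (F x e)))
  | u_neg F : b = false -> unif b F -> unif b (fun e => fneg (F e))
  | u_imp F G : b = false -> unif b F -> unif b G -> unif b (fun e => fimp (F e) (G e))
  | u_all F : b = false -> unif b (fun e => F (e 0) (fun i => e i.+1)) ->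
      unif b (fun e => fall (fun x => F x e)).

Definition econs (x : term) (e : nat -> term) : nat -> term :=
  fun i => if i is j.+1 then e j else x.

Lemma utm_reindex t (r : nat -> (nat -> term) -> term) :
  utm t -> (forall i, utm (r i)) -> utm (fun e => t (fun i => r i e)).
Proof.
move=> Ht Hr; elim: Ht => {t} [i||t _ IH|s t _ IHs _ IHt|s t _ IHs _ IHt].
- exact: Hr.
- exact: utm_zero.
- exact: utm_succ.
- exact: utm_add.
- exact: utm_mul.
Qed.

Lemma utm_weaken t : utm t -> utm (fun e => t (fun i => e i.+1)).
Proof. by move=> Ht; apply: (@utm_reindex t (fun i e => e i.+1)) => // i; apply: utm_var. Qed.

Lemma unif_reindex b F (r : nat -> (nat -> term) -> term) :
  unif b F -> (forall i, utm (r i)) -> unif b (fun e => F (fun i => r i e)).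
Proof.
move=> HF; elim: HF r => {F}.
- by move=> s t Hs Ht r Hr; apply: u_eq; apply: utm_reindex.
- by move=> s t Hs Ht r Hr; apply: u_le; apply: utm_reindex.
- by move=> s t Hs Ht r Hr; apply: u_neq; apply: utm_reindex.
- by move=> F G _ IHF _ IHG r Hr; apply: u_and; [apply: IHF|apply: IHG].
- by move=> F G _ IHF _ IHG r Hr; apply: u_or; [apply: IHF|apply: IHG].
- move=> F _ IH r Hr; apply: (@u_ex b (fun x e => F x (fun i => r i e))).
  apply: (IH (fun i => if i is j.+1 then fun e => r j (fun i => e i.+1) else fun e => e 0)).
  by case=> [|i]; [apply: utm_var|apply: utm_weaken].
- move=> t F Ht _ IH r Hr.
  apply: (@u_ball b (fun e => t (fun i => r i e)) (fun x e => F x (fun i => r i e))).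
    exact: utm_reindex.
  apply: (IH (fun i => if i is j.+1 then fun e => r j (fun i => e i.+1) else fun e => e 0)).
  by case=> [|i]; [apply: utm_var|apply: utm_weaken].
- by move=> F Hb _ IH r Hr; apply: u_neg => //; apply: IH.
- by move=> F G Hb _ IHF _ IHG r Hr; apply: u_imp => //; [apply: IHF|apply: IHG].
- move=> F Hb _ IH r Hr; apply: (@u_all b (fun x e => F x (fun i => r i e))) => //.
  apply: (IH (fun i => if i is j.+1 then fun e => r j (fun i => e i.+1) else fun e => e 0)).
  by case=> [|i]; [apply: utm_var|apply: utm_weaken].
Qed.

Lemma subst_t_num x t n : subst_t x t (num n) = num n.
Proof. by elim: n => //= n ->. Qed.

Lemma utm_subst t : utm t ->
  forall x u e, subst_t x u (t e) = t (fun i => subst_t x u (e i)).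
Proof. by elim=> {t} //= [t _ IH|s t _ IHs _ IHt|s t _ IHs _ IHt] x u e; rewrite ?IH ?IHs ?IHt. Qed.

(** At depth d the bound variables of a uniform family lie in an interval [d, d+h) that
    does not depend on its arguments, so a substitution for a variable outside it acts on
    the arguments only. *)
Lemma unif_subst b F : unif b F ->
  exists h, forall x u d e, x < d \/ d + h <= x ->
    subst x u (F e d) = F (fun i => subst_t x u (e i)) d.
Proof.
have quant (G : term -> (nat -> term) -> fm) h x u d e :
  (forall d e, x < d \/ d + h <= x ->
    subst x u (G (e 0) (fun i => e i.+1) d) =
    G (subst_t x u (e 0)) (fun i => subst_t x u (e i.+1)) d) ->
  x < d \/ d + h.+1 <= x ->
  subst x u (All d (G (Var d) e d.+1)) = All d (G (Var d) (fun i => subst_t x u (e i)) d.+1).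
  move=> IH Hx /=; have /negPf Hdx : d != x by apply/eqP; lia.
  rewrite Hdx (IH d.+1 (econs (Var d) e)); last by lia.
  by rewrite /= Hdx.
elim=> {F}.
- by move=> s t Hs Ht; exists 0 => x u d e _; rewrite /= !utm_subst.
- by move=> s t Hs Ht; exists 0 => x u d e _; rewrite /= !utm_subst.
- by move=> s t Hs Ht; exists 0 => x u d e _; rewrite /= !utm_subst.
- move=> F G _ [h IHF] _ [k IHG]; exists (h + k) => x u d e Hx.
  by rewrite /fand /= IHF ?IHG //; lia.
- move=> F G _ [h IHF] _ [k IHG]; exists (h + k) => x u d e Hx.
  by rewrite /for_ /= IHF ?IHG //; lia.
- move=> F _ [h IH]; exists h.+1 => x u d e Hx.
  rewrite /fex /Ex /Neg.
  have := @quant (fun y e => fneg (F y e)) h x u d e; rewrite /fneg /Neg /= => -> //.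
  by move=> d' e' Hx'; congr Imp; apply: (IH x u d' e').
- move=> t F Ht _ [h IH]; exists h.+1 => x u d e Hx.
  have := @quant (fun y e => fimp (fle y (t e)) (F y e)) h x u d e.
  rewrite /fall /fimp /fle => -> // d' e' Hx' /=.
  by rewrite utm_subst //; congr Imp; apply: (IH x u d' e').
- by move=> F _ _ [h IH]; exists h => x u d e Hx; rewrite /fneg /= IH.
- move=> F G _ _ [h IHF] _ [k IHG]; exists (h + k) => x u d e Hx.
  by rewrite /fimp /= IHF ?IHG //; lia.
- move=> F _ _ [h IH]; exists h.+1 => x u d e Hx.
  by rewrite /fall (@quant F h) // => d' e' Hx'; apply: (IH x u d' e').
Qed.

(** * Semantics of formulas awaiting a depth *)

(** A depth d together with an environment of which only the values of v_0, ...,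
    v_(d-1) matter.  Meanings are given as in a Kripke model: the bound variable of a
    quantifier is an arbitrary term with a value in some extension of the world.  So one
    never computes with depths. *)
Definition world := (nat * env)%type.

Definition extends (w w' : world) : Prop :=
  w.1 <= w'.1 /\ forall i, i < w.1 -> w'.2 i = w.2 i.

Definition Den (w : world) (t : term) (n : nat) : Prop :=
  forall rho, (forall i, i < w.1 -> rho i = w.2 i) -> eval rho t = n.

Definition Sem (w : world) (F : fm) (P : Prop) : Prop := sat w.2 (F w.1) <-> P.

Definition push (w : world) (n : nat) : world := (w.1.+1, upd w.2 w.1 n).

Lemma extends_refl w : extends w w. Proof. by split. Qed.

Lemma extends_trans w1 w2 w3 : extends w1 w2 -> extends w2 w3 -> extends w1 w3.
Proof.
case=> H1 H1' [H2 H2']; split; first exact: leq_trans H1 H2.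
by move=> i Hi; rewrite H2' ?H1' //; apply: leq_trans Hi H1.
Qed.

Lemma Den_extends w w' t n : extends w w' -> Den w t n -> Den w' t n.
Proof.
by move=> [H H'] Ht rho Hrho; apply: Ht => i Hi; rewrite Hrho ?H' //; apply: leq_trans Hi H.
Qed.

Lemma Den_eval w t n : Den w t n -> eval w.2 t = n.
Proof. by apply. Qed.

Lemma extends_push w n : extends w (push w n).
Proof. by split=> //= i Hi; rewrite /upd; case: eqP => // E; move: Hi; rewrite E ltnn. Qed.

Lemma Den_push w n : Den (push w n) (Var w.1) n.
Proof. by move=> rho /= ->; rewrite // /upd eqxx. Qed.

Lemma Den_zero w : Den w Zero 0. Proof. by []. Qed.

Lemma Den_succ w t n : Den w t n -> Den w (Succ t) n.+1.
Proof. by move=> H rho /H /= ->. Qed.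

Lemma Den_add w s t m n : Den w s m -> Den w t n -> Den w (Add s t) (m + n).
Proof. by move=> Hs Ht rho Hr /=; rewrite (Hs rho) ?(Ht rho). Qed.

Lemma Den_mul w s t m n : Den w s m -> Den w t n -> Den w (Mul s t) (m * n).
Proof. by move=> Hs Ht rho Hr /=; rewrite (Hs rho) ?(Ht rho). Qed.

Lemma Den_num w n : Den w (num n) n.
Proof. by move=> rho _; rewrite eval_num. Qed.

Lemma Den_var d rho i : i < d -> Den (d, rho) (Var i) (rho i).
Proof. by move=> Hi rho' /= ->. Qed.

Lemma Sem_iff w F P Q : (P <-> Q) -> Sem w F P -> Sem w F Q.
Proof. by rewrite /Sem => ->. Qed.

Lemma Sem_eq w s t m n : Den w s m -> Den w t n -> Sem w (feq s t) (m = n).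
Proof. by move=> /Den_eval <- /Den_eval <-. Qed.

Lemma Sem_le w s t m n : Den w s m -> Den w t n -> Sem w (fle s t) (m <= n).
Proof. by move=> /Den_eval <- /Den_eval <-. Qed.

Lemma Sem_lt w s t m n : Den w s m -> Den w t n -> Sem w (fle (Succ s) t) (m < n).
Proof. by move=> /Den_eval <- /Den_eval <-. Qed.

Lemma Sem_neg w F P : Sem w F P -> Sem w (fneg F) (~ P).
Proof. by rewrite /Sem /= => ->. Qed.

Lemma Sem_imp w F G P Q : Sem w F P -> Sem w G Q -> Sem w (fimp F G) (P -> Q).
Proof. by rewrite /Sem /= => -> ->. Qed.

Lemma Sem_and w F G P Q : Sem w F P -> Sem w G Q -> Sem w (fand F G) (P /\ Q).
Proof.
rewrite /Sem /= => -> ->; split=> [H|[HP HQ] H]; last exact: H.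
by split; apply: NNPP => K; apply: H => HP // HQ.
Qed.

Lemma Sem_or w F G P Q : Sem w F P -> Sem w G Q -> Sem w (for_ F G) (P \/ Q).
Proof.
rewrite /Sem /= => -> ->; split=> [H|[]//].
by case: (classic P) => HP; [left|right; apply: H].
Qed.

Lemma Sem_all w (F : term -> fm) (P : nat -> Prop) :
  (forall w' x n, extends w w' -> Den w' x n -> Sem w' (F x) (P n)) ->
  Sem w (fall F) (forall n, P n).
Proof.
move=> H; have E n := H (push w n) (Var w.1) n (extends_push w n) (@Den_push w n).
by split=> K n; apply/E; apply: K.
Qed.

Lemma Sem_ex w (F : term -> fm) (P : nat -> Prop) :
  (forall w' x n, extends w w' -> Den w' x n -> Sem w' (F x) (P n)) ->
  Sem w (fex F) (exists n, P n).
Proof.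
move=> H; have E n := H (push w n) (Var w.1) n (extends_push w n) (@Den_push w n).
split=> [K|[n /E Hn] K]; last exact: (K n).
by apply: NNPP => L; apply: K => n Hn; apply: L; exists n; apply/E.
Qed.

Lemma utm_Den t : utm t -> exists u, forall w e v, (forall i, Den w (e i) (v i)) ->
  Den w (t e) (eval v u).
Proof.
elim=> {t} [i||t _ [u IH]|s t _ [u IHs] _ [u' IHt]|s t _ [u IHs] _ [u' IHt]].
- by exists (Var i) => w e v; apply.
- by exists Zero => w e v _; apply: Den_zero.
- by exists (Succ u) => w e v H; apply/Den_succ/IH.
- by exists (Add u u') => w e v H; apply: Den_add; [apply: IHs|apply: IHt].
- by exists (Mul u u') => w e v H; apply: Den_mul; [apply: IHs|apply: IHt].
Qed.

Lemma Den_econs w w' x n e v : extends w w' -> Den w' x n -> (forall i, Den w (e i) (v i)) ->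
  forall i, Den w' (econs x e i) (scons n v i).
Proof. by move=> Hw Hx He [|i] //=; apply: Den_extends Hw (He i). Qed.

Lemma Sg_scons m (P : env -> Prop) :
  Sg m P -> Sg m (fun rho => P (scons (rho 0) (fun i => rho i.+1))).
Proof.
apply: Sg_iff => rho; suff -> : scons (rho 0) (fun i => rho i.+1) = rho by [].
by apply: functional_extensionality => -[].
Qed.

(** The relation R is found by induction on the family, with the closure properties of
    Sigma_1 predicates for each way of building it. *)
Lemma unif_Sem F : unif true F -> exists2 R, Sg 1 R &
  forall w e v, (forall i, Den w (e i) (v i)) -> Sem w (F e) (R v).
Proof.
elim=> {F} //.
- move=> s t /utm_Den [s' Hs] /utm_Den [t' Ht].
  exists (fun v => eval v s' = eval v t'); first exact/Sg1_atom/D0_eq_term.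
  by move=> w e v He; apply: Sem_eq; [apply: Hs|apply: Ht].
- move=> s t /utm_Den [s' Hs] /utm_Den [t' Ht].
  exists (fun v => eval v s' <= eval v t'); first exact/Sg1_atom/D0_le_term.
  by move=> w e v He; apply: Sem_le; [apply: Hs|apply: Ht].
- move=> s t /utm_Den [s' Hs] /utm_Den [t' Ht].
  exists (fun v => eval v s' <> eval v t'); first exact/Sg1_atom/D0_not/D0_eq_term.
  by move=> w e v He; apply/Sem_neg/Sem_eq; [apply: Hs|apply: Ht].
- move=> F G _ [P HP IHF] _ [Q HQ IHG]; exists (fun v => P v /\ Q v); first exact: Sg_and.
  by move=> w e v He; apply: Sem_and; [apply: IHF|apply: IHG].
- move=> F G _ [P HP IHF] _ [Q HQ IHG]; exists (fun v => P v \/ Q v); first exact: Sg_or.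
  by move=> w e v He; apply: Sem_or; [apply: IHF|apply: IHG].
- move=> F _ [R HR IH]; exists (fun v => exists n, R (scons n v)).
    by apply: (@Sg_ex 0 (fun n v => R (scons n v))); apply: Sg_scons.
  move=> w e v He; apply: Sem_ex => w' x n Hw Hx.
  by apply: (IH w' (econs x e)); apply: Den_econs Hw Hx He.
- move=> t F /utm_Den [u Ht] _ [R HR IH].
  exists (fun v => forall n, n <= eval v u -> R (scons n v)).
    by apply: (@Sg1_ball (fun n v => R (scons n v))); apply: Sg_scons.
  move=> w e v He; apply: Sem_all => w' x n Hw Hx; apply: Sem_imp.
    by apply: Sem_le Hx _; apply: Den_extends Hw _; apply: Ht.
  by apply: (IH w' (econs x e)); apply: Den_econs Hw Hx He.
Qed.

(** * The beta function and the pairing function *)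

Lemma chinese_family (m r : nat -> nat) N :
  (forall i j, i < j -> j < N -> coprime (m i) (m j)) ->
  exists c, forall i, i < N -> c = r i %[mod m i].
Proof.
elim: N => [|N IH] Hco; first by exists 0.
have [|c Hc] := IH; first by move=> i j Hij Hj; apply: Hco => //; apply: ltnW.
have Hp : coprime (\prod_(i < N) m i) (m N).
  rewrite coprime_sym; apply: (big_ind (fun p => coprime (m N) p)).
  - exact: coprimen1.
  - by move=> p q; rewrite coprimeMr => -> ->.
  - by move=> i _; rewrite coprime_sym; apply: Hco.
exists (chinese (\prod_(i < N) m i) (m N) c (r N)) => i; rewrite ltnS leq_eqVlt.
move=> /orP[/eqP ->|Hi]; first exact: chinese_modr.
rewrite -(Hc i Hi); apply/eqP.
have := chinese_modl Hp c (r N); move/eqP.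
have Hd : m i %| \prod_(i < N) m i by rewrite (bigD1 (Ordinal Hi)) //= dvdn_mulr.
by move=> /eqP /(congr1 (modn^~ (m i))); rewrite !modn_dvdm // => ->.
Qed.

Definition Beta (c d i y : nat) : Prop :=
  exists q, c = q * (i.+1 * d).+1 + y /\ y <= i.+1 * d.

Lemma BetaE c d i y : Beta c d i y <-> y = c %% (i.+1 * d).+1.
Proof.
split=> [[q [-> Hy]]|->].
  by rewrite modnMDl modn_small.
exists (c %/ (i.+1 * d).+1); split; first exact: divn_eq.
by rewrite -ltnS ltn_pmod.
Qed.

(** For d = M! the moduli 1 + (i+1)d with i < M are pairwise coprime: a prime dividing two
    of them divides their difference (j-i)d, where j-i divides M!, so it divides d, hence 1.
    The other summand of M makes the moduli exceed the entries. *)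
Lemma Beta_exists (s : seq nat) :
  exists c d, forall i, i < size s -> Beta c d i (nth 0 s i).
Proof.
pose M := size s + \max_(i < size s) nth 0 s i.
have [|c Hc] := @chinese_family (fun i => (i.+1 * M`!).+1) (nth 0 s) (size s).
  move=> i j Hij Hj; rewrite /coprime; apply/eqP; apply: NNPP => Hg.
  have /pdivP [p Hp] : 1 < gcdn (i.+1 * M`!).+1 (j.+1 * M`!).+1.
    by rewrite ltn_neqAle eq_sym gcdn_gt0 /= andbT; apply/eqP.
  rewrite dvdn_gcd => /andP[Hpi Hpj].
  have Hdiff : p %| (j - i) * M`!.
    have -> : (j - i) * M`! = (j.+1 * M`!).+1 - (i.+1 * M`!).+1.
      by rewrite subSS -mulnBl subSS.
    exact: dvdn_sub.
  have HpM : p %| M`!.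
    move: Hdiff; rewrite Euclid_dvdM // => /orP[|//] Hd.
    by apply: dvdn_trans Hd _; apply: dvdn_fact; rewrite /M; lia.
  move: Hpi; rewrite -addn1 dvdn_addr ?dvdn_mull // dvdn1 => /eqP Ep.
  by rewrite Ep in Hp.
exists c, M`! => i Hi; apply/BetaE; rewrite Hc // modn_small // ltnS.
apply: leq_trans (leq_pmull _ (ltn0Sn i)).
apply: leq_trans (fact_geq M).
by apply: leq_trans (leq_addl _ _); apply: (leq_bigmax (Ordinal Hi)).
Qed.

Lemma pair_code_double x y : 2 * pair_code x y = (x + y) * (x + y).+1 + 2 * y.
Proof.
rewrite /pair_code mulnDr; congr (_ + _); rewrite mul2n -[RHS]odd_double_half.
by rewrite oddM /= andbN.
Qed.

Lemma pair_code_inj x y x' y' : pair_code x y = pair_code x' y' -> x = x' /\ y = y'.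
Proof.
move=> E; have := pair_code_double x y; rewrite E pair_code_double => {}E.
have Es : x + y = x' + y' by nia.
by rewrite Es in E; lia.
Qed.

Global Opaque pair_code.

Lemma Sem_is_pair w a b z m n k : Den w a m -> Den w b n -> Den w z k ->
  Sem w (is_pair a b z) (k = pair_code m n).
Proof.
move=> Ha Hb Hz; have := pair_code_double m n => E.
apply: (@Sem_iff _ _ (k + k = (m + n) * (m + n).+1 + (n + n))).
  by split; lia.
apply: Sem_eq; first exact: Den_add.
by apply: Den_add; [apply: Den_mul; [|apply: Den_succ]|]; apply: Den_add.
Qed.

Inductive DenE (w : world) : cexp -> nat -> Prop :=
  | DenE_term t n : Den w t n -> DenE w (CTerm t) n
  | DenE_pair a b m n : DenE w a m -> DenE w b n -> DenE w (CPair a b) (pair_code m n).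

Lemma DenE_extends w w' e n : extends w w' -> DenE w e n -> DenE w' e n.
Proof.
move=> Hw; elim=> {e n} [t n H|a b m n _ IHa _ IHb]; last exact: DenE_pair.
by apply: DenE_term; apply: Den_extends Hw H.
Qed.

Lemma Sem_equals w e y m n : DenE w e n -> Den w y m -> Sem w (equals e y) (m = n).
Proof.
elim: e w y m n => [t|a IHa b IHb] w y m n /=.
  by move=> He Hy; inversion He; subst; apply: Sem_eq.
move=> He Hy; inversion He as [|a' b' k l Ha Hb]; subst.
apply: (@Sem_iff _ _ (exists u v, u = k /\ v = l /\ m = pair_code u v)).
  by split=> [[u [v [-> [->]]]]|->] //; exists k, l.
apply: Sem_ex => w1 x u H1 Hx; apply: Sem_ex => w2 z v H2 Hz.
have H12 := extends_trans H1 H2.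
apply: Sem_and; first by apply: IHa; [apply: DenE_extends Ha|apply: Den_extends Hx].
apply: Sem_and; first by apply: IHb => //; apply: DenE_extends Hb.
by apply: Sem_is_pair => //; [apply: Den_extends Hx|apply: Den_extends Hy].
Qed.

Lemma Sem_beta w c d i y mc md mi my :
  Den w c mc -> Den w d md -> Den w i mi -> Den w y my ->
  Sem w (beta c d i y) (Beta mc md mi my).
Proof.
move=> Hc Hd Hi Hy; apply: Sem_ex => w' x q Hw Hx.
move: Hc Hd Hi Hy => /(Den_extends Hw) Hc /(Den_extends Hw) Hd.
move=> /(Den_extends Hw) Hi /(Den_extends Hw) Hy.
have Hid : Den w' (Mul (Succ i) d) (mi.+1 * md) by apply: Den_mul => //; apply: Den_succ.
apply: Sem_and; last exact: Sem_le.
by apply: Sem_eq => //; apply: Den_add => //; apply: Den_mul => //; apply: Den_succ.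
Qed.

(** * Inductive definitions inside arithmetic *)

Definition mono (Phi : (nat -> Prop) -> nat -> Prop) : Prop :=
  forall X Y n, (forall k, X k -> Y k) -> Phi X n -> Phi Y n.

Definition derivation (Phi : (nat -> Prop) -> nat -> Prop) (s : seq nat) : Prop :=
  forall i, i < size s -> Phi (fun k => k \in take i s) (nth 0 s i).

(** Membership in the set generated by the rules [Phi], in the form in which arithmetic
    expresses it: by a finite sequence each entry of which follows from earlier ones.
    For finitary rules this is the least set closed under [Phi]. *)
Definition Ind (Phi : (nat -> Prop) -> nat -> Prop) (n : nat) : Prop :=
  exists2 s, derivation Phi s & n \in s.

Lemma Ind_least Phi (X : nat -> Prop) : mono Phi ->
  (forall n, Phi X n -> X n) -> forall n, Ind Phi n -> X n.
Proof.
move=> Hm HX n [s Hs /(nthP 0) [i Hi <-]] {n}.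
elim/ltn_ind: i Hi => i IH Hi; apply: HX; apply: Hm (Hs i Hi) => k.
move=> /(nthP 0) [j]; rewrite size_take Hi => Hj <-.
by rewrite nth_take //; apply: IH => //; apply: ltn_trans Hj Hi.
Qed.

Lemma derivation_cat Phi s s' : mono Phi ->
  derivation Phi s -> derivation Phi s' -> derivation Phi (s ++ s').
Proof.
move=> Hm Hs Hs' i; rewrite size_cat nth_cat take_cat => Hi'; case: (ltnP i (size s)) => Hi.
  exact: Hs.
have Hj : i - size s < size s' by lia.
by apply: Hm (Hs' _ Hj) => k; rewrite mem_cat orbC => ->.
Qed.

Lemma Ind_common Phi (l : seq nat) : mono Phi -> (forall k, k \in l -> Ind Phi k) ->
  exists2 s, derivation Phi s & forall k, k \in l -> k \in s.
Proof.
move=> Hm; elim: l => [|k l IH] H; first by exists [::].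
have [s Hs Hk] := H k (mem_head _ _).
have [|s' Hs' Hl] := IH; first by move=> j Hj; apply: H; rewrite inE Hj orbT.
exists (s ++ s'); first exact: derivation_cat.
by move=> j; rewrite inE mem_cat => /orP[/eqP ->|/Hl ->]; rewrite ?Hk ?orbT.
Qed.

(** Derivations can only be combined for finitely many premises, which is why they are
    given as a list. *)
Lemma Ind_step Phi (l : seq nat) n : mono Phi ->
  (forall k, k \in l -> Ind Phi k) -> Phi (fun k => k \in l) n -> Ind Phi n.
Proof.
move=> Hm /(Ind_common Hm) [s Hs Hl] Hn.
exists (rcons s n); last by rewrite mem_rcons mem_head.
move=> i; rewrite size_rcons ltnS leq_eqVlt nth_rcons => /orP[/eqP ->|Hi].
  rewrite ltnn eqxx; apply: Hm Hn => k /Hl Hk.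
  by rewrite -cats1 take_size_cat.
by rewrite Hi; apply: Hm (Hs i Hi) => k; rewrite -cats1 take_cat Hi.
Qed.

Definition SemE (w : world) (P : cexp -> fm) (X : nat -> Prop) : Prop :=
  forall w' e k, extends w w' -> DenE w' e k -> Sem w' (P e) (X k).

Definition SemT (w : world) (P : term -> fm) (X : nat -> Prop) : Prop :=
  forall w' t k, extends w w' -> Den w' t k -> Sem w' (P t) (X k).

Lemma SemE_extends w w' P X : extends w w' -> SemE w P X -> SemE w' P X.
Proof. by move=> H HP v e k Hv; apply: HP; apply: extends_trans Hv. Qed.

Lemma SemT_extends w w' P X : extends w w' -> SemT w P X -> SemT w' P X.
Proof. by move=> H HP v e k Hv; apply: HP; apply: extends_trans Hv. Qed.

(* Meanings persist in extensions of a world. *)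
Ltac lift H :=
  repeat match type of H with extends ?w ?w' =>
    match goal with
    | K : Den w _ _ |- _ => apply (Den_extends H) in K
    | K : DenE w _ _ |- _ => apply (DenE_extends H) in K
    | K : SemE w _ _ |- _ => apply (SemE_extends H) in K
    | K : SemT w _ _ |- _ => apply (SemT_extends H) in K
    end
  end.

(** The sequence is coded with the beta function. *)
Lemma Sem_inductively R Phi w e n : mono Phi ->
  (forall w' P X y m, extends w w' -> SemE w' P X -> Den w' y m -> Sem w' (R P y) (Phi X m)) ->
  DenE w e n -> Sem w (inductively R e) (Ind Phi n).
Proof.
move=> Hm HR He.
apply: (@Sem_iff _ _ (exists c d l x, x = n /\ Beta c d l x /\
   forall i, i <= l -> exists y, Beta c d i y /\
     Phi (fun k => exists z j, z = k /\ j < i /\ Beta c d j z) y)).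
  split.
    move=> [c [d [l [x [Ex [Hx H]]]]]]; subst x.
    pose f i := c %% (i.+1 * d).+1.
    exists (mkseq f l.+1); last first.
      by apply/mapP; exists l; [rewrite mem_iota /=; lia|apply/BetaE].
    move=> i; rewrite size_mkseq => Hi; have [y [/BetaE Ey HP]] := H i Hi.
    rewrite nth_mkseq // /f -Ey; apply: Hm HP => k [z [j [<- [Hj /BetaE ->]]]].
    apply/(nthP 0); exists j; first by rewrite size_take size_mkseq Hi.
    by rewrite nth_take // nth_mkseq //; lia.
  case=> s Hs Hn; have [c [d Hcd]] := Beta_exists s.
  have Hi : index n s < size s by rewrite index_mem.
  exists c, d, (index n s), n; split=> //; split.
    by rewrite -{2}(nth_index 0 Hn); apply: Hcd.
  move=> i Hil; have Hi' := leq_ltn_trans Hil Hi.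
  exists (nth 0 s i); split; first exact: Hcd.
  apply: Hm (Hs i Hi') => k /(nthP 0) [j]; rewrite size_take Hi' => Hj Ek.
  exists k, j; split=> //; split=> //; rewrite -Ek nth_take //.
  by apply: Hcd; apply: ltn_trans Hj Hi'.
rewrite /inductively.
apply: Sem_ex => w1 tc c H1 Hc; lift H1; apply: Sem_ex => w2 td d H2 Hd; lift H2.
apply: Sem_ex => w3 tl l H3 Hl; lift H3; apply: Sem_ex => w4 tx x H4 Hx; lift H4.
apply: Sem_and; first exact: Sem_equals.
apply: Sem_and; first exact: Sem_beta.
apply: Sem_all => w5 ti i H5 Hi; lift H5; apply: Sem_imp; first exact: Sem_le.
apply: Sem_ex => w6 ty y H6 Hy; lift H6.
apply: Sem_and; first exact: Sem_beta.
apply: HR => //.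
  exact: extends_trans H1 (extends_trans H2 (extends_trans H3 (extends_trans H4
    (extends_trans H5 H6)))).
move=> w7 e' k H7 He'; lift H7.
apply: Sem_ex => w8 tz z H8 Hz; lift H8; apply: Sem_ex => w9 tj j H9 Hj; lift H9.
apply: Sem_and; first exact: Sem_equals.
by apply: Sem_and; [apply: Sem_lt|apply: Sem_beta].
Qed.
(** * Correctness of the arithmetized syntax *)

Lemma code_tE :
  ((forall n, code_t (Var n) = pair_code 0 n) *
   (code_t Zero = pair_code 1 0) *
   (forall s, code_t (Succ s) = pair_code 2 (code_t s)) *
   (forall s t, code_t (Add s t) = pair_code 5 (pair_code (code_t s) (code_t t))) *
   (forall s t, code_t (Mul s t) = pair_code 6 (pair_code (code_t s) (code_t t))))%type.
Proof. by []. Qed.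

Lemma codeE :
  ((code Bot = pair_code 3 0) *
   (forall n A, code (All n A) = pair_code 4 (pair_code n (code A))) *
   (forall s t, code (Eq s t) = pair_code 7 (pair_code (code_t s) (code_t t))) *
   (forall s t, code (Le s t) = pair_code 8 (pair_code (code_t s) (code_t t))) *
   (forall A B, code (Imp A B) = pair_code 9 (pair_code (code A) (code B))))%type.
Proof. by []. Qed.

(* Numerals are unary, so the code of a concrete axiom must never be evaluated. *)
Global Opaque code code_t.

Ltac den := first
  [ eassumption | apply Den_num | apply Den_zero | apply Den_succ; den ].
Ltac denE := first
  [ eassumption | apply DenE_term; den | apply DenE_pair; denE ].

(** The hints are the rules for the predicates whose meaning is known. *)
Create HintDb sem.

Ltac sem_step :=
  match goal with
  | |- Sem _ (fand _ _) _ => apply Sem_and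
  | |- Sem _ (for_ _ _) _ => apply Sem_or
  | |- Sem _ (fex _) _ =>
      let w := fresh "w" in let x := fresh "x" in let n := fresh "n" in
      let H := fresh "H" in apply Sem_ex; intros w x n H ?; lift H
  | |- Sem _ (fall _) _ =>
      let w := fresh "w" in let x := fresh "x" in let n := fresh "n" in
      let H := fresh "H" in apply Sem_all; intros w x n H ?; lift H
  | |- Sem _ (fimp _ _) _ => apply Sem_imp
  | |- Sem _ (fneg _) _ => apply Sem_neg
  | |- Sem _ (feq _ _) _ => apply Sem_eq; den
  | |- Sem _ (fle _ _) _ => apply Sem_le; den
  | |- Sem _ (equals _ _) _ => apply Sem_equals; [denE|den]
  | H : SemE ?w ?P ?X |- Sem ?w (?P _) _ => apply H; [apply extends_refl|denE]
  | H : SemT ?w ?P ?X |- Sem ?w (?P _) _ => apply H; [apply extends_refl|den]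
  | |- _ => solve [auto 1 with sem nocore]
  end.
Ltac sem := repeat sem_step.

Ltac cases_in H :=
  match type of H with
  | ex _ => let x := fresh "x" in destruct H as [x H]; cases_in H
  | _ /\ _ => let K := fresh "K" in destruct H as [K H]; cases_in K; cases_in H
  | _ \/ _ => destruct H as [H|H]; cases_in H
  | _ => idtac
  end.

Ltac pinj :=
  repeat match goal with
  | H : pair_code _ _ = pair_code _ _ |- _ => apply pair_code_inj in H; destruct H
  end; subst; try discriminate.

Lemma code_t_inj s t : code_t s = code_t t -> s = t.
Proof.
elim: s t => [n||s IH|s IHs u IHu|s IHs u IHu] [m||t|t v|t v] //;
  rewrite !code_tE => E; pinj => //.
- by congr Succ; apply: IH.
- by congr Add; [apply: IHs|apply: IHu].
- by congr Mul; [apply: IHs|apply: IHu].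
Qed.

Lemma code_inj A B : code A = code B -> A = B.
Proof.
elim: A B => [|n A IH|s u|s u|A IHA A' IHA'] [|m B|t v|t v|B B'] //;
  rewrite !codeE => E; pinj => //.
- by congr All; apply: IH.
- by congr Eq; apply: code_t_inj.
- by congr Le; apply: code_t_inj.
- by congr Imp; [apply: IHA|apply: IHA'].
Qed.

Definition term_rule (X : nat -> Prop) (y : nat) : Prop :=
  (exists n, y = pair_code 0 n) \/ y = pair_code 1 0 \/
  (exists a, y = pair_code 2 a /\ X a) \/
  (exists k a b, 5 <= k /\ k <= 6 /\ y = pair_code k (pair_code a b) /\ X a /\ X b).

Definition term_code (n : nat) : Prop := exists s, n = code_t s.
Definition form_code (n : nat) : Prop := exists A, n = code A.

Ltac mono_go HXY :=
  match goal with
  | |- (_ \/ _) -> _ => let H := fresh in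
      intros [H|H]; [left; revert H|right; revert H]; mono_go HXY
  | |- (exists _, _) -> _ => let x := fresh in let H := fresh in
      intros [x H]; exists x; revert H; mono_go HXY
  | |- (_ /\ _) -> _ => let H := fresh in let K := fresh in
      intros [H K]; split; [revert H; clear K|revert K; clear H]; mono_go HXY
  | |- _ => first [exact (fun H => H) | apply HXY]
  end.
Ltac mono_tac := let X := fresh in let Y := fresh in let n := fresh in
  let HXY := fresh in intros X Y n HXY; mono_go HXY.

Lemma mono_term_rule : mono term_rule.
Proof. rewrite /term_rule; mono_tac. Qed.

Lemma Ind_term n : Ind term_rule n <-> term_code n.
Proof.
split.
  apply: Ind_least; first exact: mono_term_rule.
  move=> {}n [[m ->]|[->|[[a [-> [s ->]]]|[k [a [b [H1 [H2 [-> [[s ->] [t ->]]]]]]]]]]].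
  - by exists (Var m).
  - by exists Zero.
  - by exists (Succ s).
  - by have [->|->] : k = 5 \/ k = 6 by [lia|]; [exists (Add s t)|exists (Mul s t)].
case=> s -> {n}; have Hm := mono_term_rule.
elim: s => [m||s IH|s IHs t IHt|s IHs t IHt]; rewrite code_tE.
- by apply: (@Ind_step _ [::]) => //; left; exists m.
- by apply: (@Ind_step _ [::]) => //; right; left.
- apply: (@Ind_step _ [:: code_t s]) => //; first by move=> k; rewrite inE => /eqP ->.
  by do 2!right; left; exists (code_t s); rewrite mem_head.
- apply: (@Ind_step _ [:: code_t s; code_t t]) => //.
    by move=> k; rewrite !inE => /orP[] /eqP ->.
  by do 3!right; exists 5, (code_t s), (code_t t); rewrite !inE !eqxx orbT.
- apply: (@Ind_step _ [:: code_t s; code_t t]) => //.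
    by move=> k; rewrite !inE => /orP[] /eqP ->.
  by do 3!right; exists 6, (code_t s), (code_t t); rewrite !inE !eqxx orbT.
Qed.

Lemma Sem_is_term w t n : Den w t n -> Sem w (is_term t) (term_code n).
Proof.
move=> Ht; apply: Sem_iff (Ind_term n) _; apply: Sem_inductively.
- exact: mono_term_rule.
- by move=> w' P X y m Hw HP Hy; rewrite /term_rule; sem.
- exact: DenE_term.
Qed.

#[local] Hint Extern 0 (Sem _ (is_term _) _) => (apply Sem_is_term; den) : sem.

Definition form_rule (X : nat -> Prop) (y : nat) : Prop :=
  y = pair_code 3 0 \/
  (exists x a, y = pair_code 4 (pair_code x a) /\ X a) \/
  (exists k s t, 7 <= k /\ k <= 8 /\ y = pair_code k (pair_code s t) /\
     term_code s /\ term_code t) \/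
  (exists a b, y = pair_code 9 (pair_code a b) /\ X a /\ X b).

Lemma mono_form_rule : mono form_rule.
Proof. rewrite /form_rule; mono_tac. Qed.

Lemma Ind_form n : Ind form_rule n <-> form_code n.
Proof.
split.
  apply: Ind_least; first exact: mono_form_rule.
  move=> {}n [->|[[x [a [-> [A ->]]]]|[[k [s [t [H1 [H2 [-> [[s' ->] [t' ->]]]]]]]]|]]].
  - by exists Bot.
  - by exists (All x A).
  - by have [->|->] : k = 7 \/ k = 8 by [lia|]; [exists (Eq s' t')|exists (Le s' t')].
  - by move=> [a [b [-> [[A ->] [B ->]]]]]; exists (Imp A B).
case=> A -> {n}; have Hm := mono_form_rule.
elim: A => [|x A IH|s t|s t|A IHA B IHB]; rewrite codeE.
- by apply: (@Ind_step _ [::]) => //; left.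
- apply: (@Ind_step _ [:: code A]) => //; first by move=> k; rewrite inE => /eqP ->.
  by right; left; exists x, (code A); rewrite mem_head.
- apply: (@Ind_step _ [::]) => //; do 2!right; left.
  by exists 7, (code_t s), (code_t t); do !split => //; [exists s|exists t].
- apply: (@Ind_step _ [::]) => //; do 2!right; left.
  by exists 8, (code_t s), (code_t t); do !split => //; [exists s|exists t].
- apply: (@Ind_step _ [:: code A; code B]) => //.
    by move=> k; rewrite !inE => /orP[] /eqP ->.
  by do 3!right; exists (code A), (code B); rewrite !inE !eqxx orbT.
Qed.

Lemma Sem_is_form w t n : Den w t n -> Sem w (is_form t) (form_code n).
Proof.
move=> Ht; apply: Sem_iff (Ind_form n) _; apply: Sem_inductively.
- exact: mono_form_rule.
- by move=> w' P X y m Hw HP Hy; rewrite /form_rule; sem.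
- exact: DenE_term.
Qed.

#[local] Hint Extern 0 (Sem _ (is_form _) _) => (apply Sem_is_form; den) : sem.

Definition fresh_rule (x : nat) (X : nat -> Prop) (y : nat) : Prop :=
  (exists n, n <> x /\ y = pair_code 0 n) \/ y = pair_code 1 0 \/ y = pair_code 3 0 \/
  (exists a, y = pair_code 2 a /\ X a) \/
  (exists n a, y = pair_code 4 (pair_code n a) /\ (n = x \/ X a)) \/
  (exists k a b, 5 <= k /\ k <= 9 /\ y = pair_code k (pair_code a b) /\ X a /\ X b).

Lemma mono_fresh_rule x : mono (fresh_rule x).
Proof. rewrite /fresh_rule; mono_tac. Qed.

Lemma Sem_is_fresh w x e n m : Den w x n -> Den w e m ->
  Sem w (is_fresh x e) (Ind (fresh_rule n) m).
Proof.
move=> Hx He; apply: Sem_inductively.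
- exact: mono_fresh_rule.
- by move=> w' P X y k Hw HP Hy; lift Hw; rewrite /fresh_rule; sem.
- exact: DenE_term.
Qed.

#[local] Hint Extern 0 (Sem _ (is_fresh _ _) _) => (apply Sem_is_fresh; den) : sem.

(** Both claims are proved at once because a formula contains terms; numbers that are not
    codes satisfy them vacuously, which is why the rules need not exclude such numbers. *)
Lemma Ind_fresh_sound x n : Ind (fresh_rule x) n ->
  (forall s, n = code_t s -> ~~ free_t x s) /\ (forall A, n = code A -> ~~ free x A).
Proof.
move: n; apply: Ind_least; first exact: mono_fresh_rule.
move=> n; rewrite /fresh_rule => H; split=> [s|A] E; subst n.
  case: s H => [m||s|s t|s t]; rewrite code_tE => H; cases_in H; pinj => //=.
  - by apply/eqP.
  - by eauto.
  - by rewrite negb_or; apply/andP; eauto.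
  - by rewrite negb_or; apply/andP; eauto.
case: A H => [|m A|s t|s t|A B]; rewrite codeE => H; cases_in H; pinj => //=.
- by rewrite eqxx.
- by rewrite negb_and; apply/orP; eauto.
- by rewrite negb_or; apply/andP; eauto.
- by rewrite negb_or; apply/andP; eauto.
- by rewrite negb_or; apply/andP; eauto.
Qed.

Lemma Ind_fresh_term x s : Ind (fresh_rule x) (code_t s) <-> ~~ free_t x s.
Proof.
split; first by move=> /Ind_fresh_sound [H _]; apply: H.
have Hm := @mono_fresh_rule x.
elim: s => [m||s IH|s IHs t IHt|s IHs t IHt] /=; rewrite ?negb_or code_tE.
- by move=> /eqP Hx; apply: (@Ind_step _ [::]) => //; left; exists m.
- by move=> _; apply: (@Ind_step _ [::]) => //; right; left.
- move=> /IH H; apply: (@Ind_step _ [:: code_t s]) => //; first by move=> k; rewrite inE => /eqP ->.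
  by do 3!right; left; exists (code_t s); rewrite mem_head.
- move=> /andP[/IHs Hs /IHt Ht]; apply: (@Ind_step _ [:: code_t s; code_t t]) => //.
    by move=> k; rewrite !inE => /orP[] /eqP ->.
  by do 5!right; exists 5, (code_t s), (code_t t); rewrite !inE !eqxx orbT.
- move=> /andP[/IHs Hs /IHt Ht]; apply: (@Ind_step _ [:: code_t s; code_t t]) => //.
    by move=> k; rewrite !inE => /orP[] /eqP ->.
  by do 5!right; exists 6, (code_t s), (code_t t); rewrite !inE !eqxx orbT.
Qed.

Lemma Ind_fresh_form x A : Ind (fresh_rule x) (code A) <-> ~~ free x A.
Proof.
split; first by move=> /Ind_fresh_sound [_ H]; apply: H.
have Hm := @mono_fresh_rule x.
elim: A => [|m A IH|s t|s t|A IHA B IHB] /=; rewrite ?negb_or codeE.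
- by move=> _; apply: (@Ind_step _ [::]) => //; do 2!right; left.
- rewrite negb_and negbK => /orP[/eqP Hx|/IH H].
    apply: (@Ind_step _ [::]) => //; do 4!right; left.
    by exists m, (code A); split=> //; left.
  apply: (@Ind_step _ [:: code A]) => //; first by move=> k; rewrite inE => /eqP ->.
  by do 4!right; left; exists m, (code A); rewrite mem_head; split=> //; right.
- move=> /andP[/Ind_fresh_term Hs /Ind_fresh_term Ht].
  apply: (@Ind_step _ [:: code_t s; code_t t]) => //.
    by move=> k; rewrite !inE => /orP[] /eqP ->.
  by do 5!right; exists 7, (code_t s), (code_t t); rewrite !inE !eqxx orbT.
- move=> /andP[/Ind_fresh_term Hs /Ind_fresh_term Ht].
  apply: (@Ind_step _ [:: code_t s; code_t t]) => //.
    by move=> k; rewrite !inE => /orP[] /eqP ->.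
  by do 5!right; exists 8, (code_t s), (code_t t); rewrite !inE !eqxx orbT.
- move=> /andP[/IHA Hs /IHB Ht]; apply: (@Ind_step _ [:: code A; code B]) => //.
    by move=> k; rewrite !inE => /orP[] /eqP ->.
  by do 5!right; exists 9, (code A), (code B); rewrite !inE !eqxx orbT.
Qed.

Definition subst_rule (x t : nat) (X : nat -> Prop) (y : nat) : Prop :=
  exists a b, y = pair_code a b /\
    ((a = pair_code 0 x /\ b = t) \/
     (exists n, n <> x /\ a = pair_code 0 n /\ b = a) \/
     ((a = pair_code 1 0 \/ a = pair_code 3 0) /\ b = a) \/
     (exists u u', a = pair_code 2 u /\ b = pair_code 2 u' /\ X (pair_code u u')) \/
     (exists n u, a = pair_code 4 (pair_code n u) /\
        ((n = x /\ b = a) \/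
         (exists u', n <> x /\ (Ind (fresh_rule n) t \/ Ind (fresh_rule x) u) /\
            b = pair_code 4 (pair_code n u') /\ X (pair_code u u')))) \/
     (exists k u v u' v', 5 <= k /\ k <= 9 /\
        a = pair_code k (pair_code u v) /\ b = pair_code k (pair_code u' v') /\
        X (pair_code u u') /\ X (pair_code v v'))).

Lemma mono_subst_rule x t : mono (subst_rule x t).
Proof. rewrite /subst_rule; mono_tac. Qed.

Lemma Sem_is_subst w x t e e' nx nt n n' :
  Den w x nx -> Den w t nt -> Den w e n -> Den w e' n' ->
  Sem w (is_subst x t e e') (Ind (subst_rule nx nt) (pair_code n n')).
Proof.
move=> Hx Ht He He'; apply: Sem_inductively.
- exact: mono_subst_rule.
- by move=> w' P X y k Hw HP Hy; lift Hw; rewrite /subst_rule; sem.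
- by denE.
Qed.

#[local] Hint Extern 0 (Sem _ (is_subst _ _ _ _) _) => (apply Sem_is_subst; den) : sem.

Lemma Ind_subst_sound x t p : Ind (subst_rule x (code_t t)) p ->
  forall a b, p = pair_code a b ->
    (forall s, a = code_t s -> b = code_t (subst_t x t s)) /\
    (forall A, a = code A -> substitutable x t A /\ b = code (subst x t A)).
Proof.
move: p; apply: Ind_least; first exact: mono_subst_rule.
move=> p; rewrite /subst_rule => -[a [b [-> H]]] a' b' /pair_code_inj [<- <-] {p a' b'}.
split=> [s|A] E; subst a.
  case: s H => [m||s|s u|s u]; rewrite code_tE => H; cases_in H; pinj => //=;
    rewrite ?code_tE ?eqxx //.
  - by case: eqP.
  - by have [H' _] := H _ _ erefl; rewrite (H' _ erefl).
  - have [H1 _] := K3 _ _ erefl; have [H2 _] := H _ _ erefl.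
    by rewrite (H1 _ erefl) (H2 _ erefl).
  - have [H1 _] := K3 _ _ erefl; have [H2 _] := H _ _ erefl.
    by rewrite (H1 _ erefl) (H2 _ erefl).
case: A H => [|m A|s u|s u|A B]; rewrite codeE => H; cases_in H; pinj => //=;
  rewrite ?codeE ?eqxx ?codeE //.
- have /eqP/negPf Hx := K0; have [_ /(_ _ erefl) [HA ->]] := H _ _ erefl.
  by rewrite HA orbC andbT (Ind_fresh_term _ _).1 //= Hx codeE.
- have /eqP/negPf Hx := K0; have [_ /(_ _ erefl) [HA ->]] := H _ _ erefl.
  by rewrite HA orbC andbT (Ind_fresh_form _ _).1 // orbT /= Hx codeE.
- have [H1 _] := K3 _ _ erefl; have [H2 _] := H _ _ erefl.
  by rewrite (H1 _ erefl) (H2 _ erefl).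
- have [H1 _] := K3 _ _ erefl; have [H2 _] := H _ _ erefl.
  by rewrite (H1 _ erefl) (H2 _ erefl).
- have [_ /(_ _ erefl) [H1 ->]] := K3 _ _ erefl.
  by have [_ /(_ _ erefl) [H2 ->]] := H _ _ erefl; rewrite H1 H2.
Qed.

Lemma Ind_subst_term x t s :
  Ind (subst_rule x (code_t t)) (pair_code (code_t s) (code_t (subst_t x t s))).
Proof.
have Hm := @mono_subst_rule x (code_t t).
have op k a b a' b' : 5 <= k -> k <= 9 ->
    Ind (subst_rule x (code_t t)) (pair_code a a') ->
    Ind (subst_rule x (code_t t)) (pair_code b b') ->
    Ind (subst_rule x (code_t t))
      (pair_code (pair_code k (pair_code a b)) (pair_code k (pair_code a' b'))).
  move=> H5 H9 Ha Hb; apply: (@Ind_step _ [:: pair_code a a'; pair_code b b']) => //.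
    by move=> i; rewrite !inE => /orP[] /eqP ->.
  exists (pair_code k (pair_code a b)), (pair_code k (pair_code a' b')); split=> //.
  by do 5!right; exists k, a, b, a', b'; rewrite !inE !eqxx orbT.
elim: s => [m||s IH|s IHs u IHu|s IHs u IHu] /=; rewrite ?code_tE.
- apply: (@Ind_step _ [::]) => //; case: eqP => Hx.
    by exists (pair_code 0 m), (code_t t); split=> //; left; rewrite Hx.
  exists (pair_code 0 m), (pair_code 0 m); rewrite code_tE; split=> //.
  by right; left; exists m.
- apply: (@Ind_step _ [::]) => //; exists (pair_code 1 0), (pair_code 1 0); split=> //.
  by do 2!right; left; split=> //; left.
- apply: (@Ind_step _ [:: pair_code (code_t s) (code_t (subst_t x t s))]) => //.
    by move=> k; rewrite inE => /eqP ->.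
  exists (pair_code 2 (code_t s)), (pair_code 2 (code_t (subst_t x t s))); split=> //.
  by do 3!right; left; exists (code_t s), (code_t (subst_t x t s)); rewrite mem_head.
- exact: op.
- exact: op.
Qed.

Lemma Ind_subst_form x t A m :
  Ind (subst_rule x (code_t t)) (pair_code (code A) m) <->
  substitutable x t A /\ m = code (subst x t A).
Proof.
split; first by move=> /Ind_subst_sound /(_ _ _ erefl) [_]; apply.
have Hm := @mono_subst_rule x (code_t t).
have op k a b a' b' : 5 <= k -> k <= 9 ->
    Ind (subst_rule x (code_t t)) (pair_code a a') ->
    Ind (subst_rule x (code_t t)) (pair_code b b') ->
    Ind (subst_rule x (code_t t))
      (pair_code (pair_code k (pair_code a b)) (pair_code k (pair_code a' b'))).
  move=> H5 H9 Ha Hb; apply: (@Ind_step _ [:: pair_code a a'; pair_code b b']) => //.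
    by move=> i; rewrite !inE => /orP[] /eqP ->.
  exists (pair_code k (pair_code a b)), (pair_code k (pair_code a' b')); split=> //.
  by do 5!right; exists k, a, b, a', b'; rewrite !inE !eqxx orbT.
case=> H -> {m}.
elim: A H => [|n A IH|s u|s u|A IHA B IHB] /=; rewrite ?codeE => H.
- apply: (@Ind_step _ [::]) => //; exists (pair_code 3 0), (pair_code 3 0); split=> //.
  by do 2!right; left; split=> //; right.
- have [Ex|Hx] := eqVneq n x.
    apply: (@Ind_step _ [::]) => //.
    exists (pair_code 4 (pair_code n (code A))), (pair_code 4 (pair_code n (code A))).
    by rewrite codeE; split=> //; do 4!right; left; exists n, (code A); split=> //; left.
  move: H; rewrite (negPf Hx) /= => /andP[/orP Hf HA].
  apply: (@Ind_step _ [:: pair_code (code A) (code (subst x t A))]) => //.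
    by move=> k; rewrite inE => /eqP ->; apply: IH.
  exists (pair_code 4 (pair_code n (code A))), (pair_code 4 (pair_code n (code (subst x t A)))).
  rewrite codeE; split=> //; do 4!right; left; exists n, (code A); split=> //; right.
  exists (code (subst x t A)); rewrite mem_head; split; first exact/eqP.
  split=> //; case: Hf => Hf; [left; exact/Ind_fresh_term|right; exact/Ind_fresh_form].
- by apply: op => //; apply: Ind_subst_term.
- by apply: op => //; apply: Ind_subst_term.
- by move/andP: H => [HA HB]; apply: op => //; [apply: IHA|apply: IHB].
Qed.

Definition num_rule (X : nat -> Prop) (y : nat) : Prop :=
  y = pair_code 0 (pair_code 1 0) \/
  (exists m u, y = pair_code m.+1 (pair_code 2 u) /\ X (pair_code m u)).

Lemma mono_num_rule : mono num_rule.
Proof. rewrite /num_rule; mono_tac. Qed.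

Lemma Ind_num n c : Ind num_rule (pair_code n c) <-> c = code_t (num n).
Proof.
have Hm := mono_num_rule; split.
  suff H p : Ind num_rule p -> forall n c, p = pair_code n c -> c = code_t (num n).
    by move=> /H; apply.
  move: p {n c}; apply: Ind_least => // p H n c E; rewrite /num_rule in H; subst.
  cases_in H; pinj; first by rewrite code_tE.
  by rewrite /= -/(num x) code_tE -(H _ _ erefl).
move=> -> {c}; elim: n => [|n IH].
  by apply: (@Ind_step _ [::]) => //; left; rewrite code_tE.
apply: (@Ind_step _ [:: pair_code n (code_t (num n))]) => //.
  by move=> k; rewrite inE => /eqP ->.
by right; exists n, (code_t (num n)); rewrite mem_head /= -/(num n) code_tE.
Qed.

Lemma Sem_is_num w n c k m : Den w n k -> Den w c m ->
  Sem w (is_num n c) (m = code_t (num k)).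
Proof.
move=> Hn Hc; apply: Sem_iff (Ind_num k m) _; apply: Sem_inductively.
- exact: mono_num_rule.
- by move=> w' P X y j Hw HP Hy; rewrite /num_rule; sem.
- by denE.
Qed.

#[local] Hint Extern 0 (Sem _ (is_num _ _) _) => (apply Sem_is_num; den) : sem.

Local Notation cimp a b := (pair_code 9 (pair_code a b)).
Local Notation call x a := (pair_code 4 (pair_code x a)).
Local Notation ceq a b := (pair_code 7 (pair_code a b)).
Local Notation cneg a := (cimp a (pair_code 3 0)).

Definition logical_axiom_code (n : nat) : Prop :=
  (exists a b, form_code a /\ form_code b /\ n = cimp a (cimp b a)) \/
  (exists a b c, form_code a /\ form_code b /\ form_code c /\
     n = cimp (cimp a (cimp b c)) (cimp (cimp a b) (cimp a c))) \/
  (exists a, form_code a /\ n = cimp (cneg (cneg a)) a) \/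
  (exists x t a b, term_code t /\ form_code a /\
     Ind (subst_rule x t) (pair_code a b) /\ n = cimp (call x a) b) \/
  (exists x a b, form_code a /\ form_code b /\ Ind (fresh_rule x) a /\
     n = cimp (call x (cimp a b)) (cimp a (call x b))) \/
  (exists t, term_code t /\ n = ceq t t) \/
  (exists x s t a b c, term_code s /\ term_code t /\ form_code a /\
     Ind (subst_rule x s) (pair_code a b) /\ Ind (subst_rule x t) (pair_code a c) /\
     n = cimp (ceq s t) (cimp b c)).

Lemma logical_axiom_codeP n :
  logical_axiom_code n <-> exists A, logical_axiom A /\ n = code A.
Proof.
rewrite /logical_axiom_code; split=> [H|[A [HA ->]]].
  cases_in H; repeat match goal with
  | K : form_code _ |- _ => destruct K as [? ->]
  | K : term_code _ |- _ => destruct K as [? ->]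
  | K : Ind (subst_rule _ _) _ |- _ => apply Ind_subst_form in K; destruct K as [? ->]
  end.
  - by eexists; split; last (rewrite H -!codeE; reflexivity); apply: LA_K.
  - by eexists; split; last (rewrite H -!codeE; reflexivity); apply: LA_S.
  - by eexists; split; last (rewrite H -!codeE; reflexivity); apply: LA_DN.
  - by eexists; split; last (rewrite H -!codeE; reflexivity); apply: LA_inst.
  - move/Ind_fresh_form: K1 => K1.
    by eexists; split; last (rewrite H -!codeE; reflexivity); apply: LA_dist.
  - by eexists; split; last (rewrite H -!codeE; reflexivity); apply: LA_refl.
  - by eexists; split; last (rewrite H -!codeE; reflexivity); apply: LA_leibniz.
case: HA => [B C|B C D|B|x t B Hs|x B C Hx|t|x s t B Hs Ht]; rewrite !codeE.
- by left; exists (code B), (code C); do !split; [exists B|exists C].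
- by right; left; exists (code B), (code C), (code D); do !split; [exists B|exists C|exists D].
- by do 2!right; left; exists (code B); do !split; exists B.
- do 3!right; left; exists x, (code_t t), (code B), (code (subst x t B)).
  by do 2!(split; first by eexists); split=> //; apply/Ind_subst_form.
- do 4!right; left; exists x, (code B), (code C).
  by do 2!(split; first by eexists); split=> //; apply/Ind_fresh_form.
- by do 5!right; left; exists (code_t t); split=> //; exists t.
- do 6!right; exists x, (code_t s), (code_t t), (code B), (code (subst x s B)), (code (subst x t B)).
  by do 3!(split; first by eexists); do 2!(split; first exact/Ind_subst_form).
Qed.

Lemma Sem_is_logical_axiom w y n : Den w y n ->
  Sem w (is_logical_axiom y) (exists A, logical_axiom A /\ n = code A).
Proof.
move=> Hy; apply: Sem_iff (logical_axiom_codeP n) _.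
by rewrite /is_logical_axiom /logical_axiom_code; sem.
Qed.

#[local] Hint Extern 0 (Sem _ (is_logical_axiom _) _) => (apply Sem_is_logical_axiom; den) : sem.

Lemma Sem_basic_axioms w y n l G P : Den w y n -> Sem w G P ->
  Sem w (foldr (fun A F => for_ (feq y (num (code A))) F) G l)
    ((exists i, i < size l /\ n = code (nth Bot l i)) \/ P).
Proof.
move=> Hy HG; elim: l => [|A l IH].
  by apply: Sem_iff HG; split; [right|case=> // -[i []]].
apply: (@Sem_iff _ _ (n = code A \/ (exists i, i < size l /\ n = code (nth Bot l i)) \/ P)).
  split=> [[->|[[i [Hi ->]]|HP]]|[[[|i] [Hi ->]]|HP]].
  - by left; exists 0.
  - by left; exists i.+1.
  - by right.
  - by left.
  - by right; left; exists i.
  - by right; right.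
by apply: Sem_or IH; apply: Sem_eq; den.
Qed.

Definition induction_code (n : nat) : Prop :=
  exists x a zero succ b c, form_code a /\
    zero = pair_code 1 0 /\ Ind (subst_rule x zero) (pair_code a b) /\
    succ = pair_code 2 (pair_code 0 x) /\ Ind (subst_rule x succ) (pair_code a c) /\
    n = cimp b (cimp (call x (cimp a c)) (call x a)).

Lemma induction_codeP n :
  induction_code n <-> exists x A, n = code (induction_axiom x A).
Proof.
split=> [[x [a [z [s [b [c]]]]]]|[x [A ->]]].
  rewrite -(code_tE.1.1.1.1 x) -(code_tE.1.1.2) -code_tE.1.1.1.2.
  move=> [[A ->]] [-> [/Ind_subst_form [_ ->] [-> [/Ind_subst_form [_ ->] ->]]]].
  by exists x, A; rewrite /induction_axiom !codeE.
exists x, (code A), (code_t Zero), (code_t (Succ (Var x))).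
exists (code (subst x Zero A)), (code (subst x (Succ (Var x)) A)).
split; first by exists A.
split; first by rewrite code_tE.
split; first by apply/Ind_subst_form; split=> //; apply: (substitutable_num x 0).
split; first by rewrite !code_tE.
split; first by apply/Ind_subst_form; split=> //; apply: substitutable_succ.
by rewrite /induction_axiom !codeE.
Qed.

Lemma Sem_is_PA_axiom w y n : Den w y n ->
  Sem w (is_PA_axiom y) (exists A, PA A /\ n = code A).
Proof.
move=> Hy; apply: (@Sem_iff _ _ ((exists i, i < size PA_basic /\
    n = code (nth Bot PA_basic i)) \/ induction_code n)).
  split.
    case=> [[i [Hi ->]]|/induction_codeP [x [A ->]]].
      by exists (nth Bot PA_basic i); split=> //; apply: PA_basic_axiom.
    by exists (induction_axiom x A); split=> //; apply: PA_induction.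
  case=> A [[i Hi|x B] ->]; first by left; exists i.
  by right; apply/induction_codeP; exists x, B.
apply: Sem_basic_axioms => //; rewrite /induction_code.
by sem.
Qed.

#[local] Hint Extern 0 (Sem _ (is_PA_axiom _) _) => (apply Sem_is_PA_axiom; den) : sem.

(** ** Provability *)

Definition prv_rule (Q X : nat -> Prop) (y : nat) : Prop :=
  (exists A, logical_axiom A /\ y = code A) \/ (form_code y /\ Q y) \/
  (exists a, X a /\ X (cimp a y)) \/ (exists x a, y = call x a /\ X a).

Lemma mono_prv_rule Q : mono (prv_rule Q).
Proof. rewrite /prv_rule; mono_tac. Qed.

(** Modus ponens is the only rule where the conclusion is not built from the premises: it
    is a formula because the code of the major premise is one. *)
Lemma Ind_prv Q n : Ind (prv_rule Q) n <->
  exists A, n = code A /\ prv (fun B => Q (code B)) A.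
Proof.
have Hm := @mono_prv_rule Q; split.
  move: n; apply: Ind_least => // n.
  case=> [[A [HA ->]]|[[[A ->] HA]|[[a [[A [-> HA]] [B [E HB]]]]|[x [a [-> [A [-> HA]]]]]]]].
  - by exists A; split=> //; apply: prv_log.
  - by exists A; split=> //; apply: prv_ax.
  - case: B E HB => [|? ?|? ?|? ?|B C]; rewrite codeE => E HB; pinj.
    by exists C; split=> //; move/code_inj: H0 => ?; subst; apply: prv_mp HA HB.
  - by exists (All x A); rewrite codeE; split=> //; apply: prv_gen.
case=> A [-> H] {n}; elim: H => {A} [A HA|A HA|A B _ IHA _ IHB|x A _ IH].
- by apply: (@Ind_step _ [::]) => //; right; left; split=> //; exists A.
- by apply: (@Ind_step _ [::]) => //; left; exists A.
- apply: (@Ind_step _ [:: code A; code (Imp A B)]) => //.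
    by move=> k; rewrite !inE => /orP[] /eqP ->.
  by do 2!right; left; exists (code A); rewrite !inE -codeE !eqxx orbT.
- apply: (@Ind_step _ [:: code A]) => //; first by move=> k; rewrite inE => /eqP ->.
  by do 3!right; exists x, (code A); rewrite mem_head codeE.
Qed.

Lemma Sem_Prv w ax Q f n : SemT w ax Q -> Den w f n ->
  Sem w (Prv ax f) (exists A, n = code A /\ prv (fun B => Q (code B)) A).
Proof.
move=> Hax Hf; apply: Sem_iff (Ind_prv Q n) _; apply: Sem_inductively.
- exact: mono_prv_rule.
- by move=> w' P X y m Hw HP Hy; lift Hw; rewrite /prv_rule; sem.
- by denE.
Qed.

(** * Uniformity of the arithmetized notions *)

(** The axioms of a theory enter [Prv] as a parameter that may depend on the same terms. *)
Lemma unif_ax b (ax : (nat -> term) -> term -> fm) (r : nat -> (nat -> term) -> term) t :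
  unif b (fun e => ax (fun i => e i.+1) (e 0)) -> (forall i, utm (r i)) -> utm t ->
  unif b (fun e => ax (fun i => r i e) (t e)).
Proof.
move=> H Hr Ht; apply: (unif_reindex (r := fun i => if i is j.+1 then r j else t) H).
by case.
Qed.

Lemma u_iff b F G : b = false -> unif b F -> unif b G -> unif b (fun e => fiff (F e) (G e)).
Proof.
move=> Hb HF HG; apply: (@u_and b (fun e => fimp (F e) (G e)) (fun e => fimp (G e) (F e)));
  exact: u_imp.
Qed.

Ltac u_tm :=
  lazymatch goal with
  | |- utm (fun _ => num _) => apply utm_num
  | |- utm (fun _ => Zero) => apply utm_zero
  | |- utm (fun _ => Succ _) => apply utm_succ; u_tm
  | |- utm (fun _ => Add _ _) => apply utm_add; u_tm
  | |- utm (fun _ => Mul _ _) => apply utm_mul; u_tm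
  | _ => first [ assumption | apply utm_var
               | match goal with
                 | H : utm ?t |- utm (fun e => ?t _) =>
                     refine (@utm_reindex t (fun i e => _) H _);
                     let i := fresh in intro i; apply utm_var
                 end ]
  end.

Create HintDb unif.

Ltac u_step :=
  lazymatch goal with
  | |- unif _ (fun _ => fand _ _) => apply u_and
  | |- unif _ (fun _ => for_ _ _) => apply u_or
  | |- unif _ (fun _ => fex _) => apply u_ex; cbv beta
  | |- unif _ (fun _ => feq _ _) => apply u_eq; u_tm
  | |- unif _ (fun _ => fle _ _) => apply u_le; u_tm
  | |- unif _ (fun _ => fneg (feq _ _)) => apply u_neq; u_tm
  | |- unif _ (fun _ => fneg _) => apply u_neg; [reflexivity|]
  | |- unif _ (fun _ => fall (fun x => fimp (fle x _) _)) => apply u_ball; [u_tm|cbv beta]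
  | |- unif _ (fun _ => fall _) => apply u_all; [reflexivity|cbv beta]
  | |- unif _ (fun _ => fimp _ _) => apply u_imp; [reflexivity| |]
  | |- unif _ (fun _ => fiff _ _) => apply u_iff; [reflexivity| |]
  | _ => first
      [ match goal with
        | H : unif ?b (fun e => ?ax (fun i => e i.+1) (e 0)) |- unif ?b (fun e => ?ax _ _) =>
            refine (@unif_ax b ax (fun i e => _) (fun e => _) H _ _);
            [let i := fresh in intro i; apply utm_var|u_tm]
        end
      | solve [auto 1 with unif nocore] ]
  end.

Ltac u_solve := cbv [inductively equals beta is_pair c_op c_Var c_Zero c_Succ c_Bot c_All
  c_Eq c_Imp c_Neg]; repeat u_step.

Lemma u_is_term b t : utm t -> unif b (fun e => is_term (t e)).
Proof. by move=> Ht; rewrite /is_term; u_solve. Qed.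

#[local] Hint Extern 0 (unif _ (fun _ => is_term _)) => (apply u_is_term; u_tm) : unif.

Lemma u_is_form b t : utm t -> unif b (fun e => is_form (t e)).
Proof. by move=> Ht; rewrite /is_form; u_solve. Qed.

#[local] Hint Extern 0 (unif _ (fun _ => is_form _)) => (apply u_is_form; u_tm) : unif.

Lemma u_is_fresh b x t : utm x -> utm t -> unif b (fun e => is_fresh (x e) (t e)).
Proof. by move=> Hx Ht; rewrite /is_fresh; u_solve. Qed.

#[local] Hint Extern 0 (unif _ (fun _ => is_fresh _ _)) => (apply u_is_fresh; u_tm) : unif.

Lemma u_is_num b n c : utm n -> utm c -> unif b (fun e => is_num (n e) (c e)).
Proof. by move=> Hn Hc; rewrite /is_num; u_solve. Qed.

#[local] Hint Extern 0 (unif _ (fun _ => is_num _ _)) => (apply u_is_num; u_tm) : unif.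

Lemma u_is_subst b x t s s' : utm x -> utm t -> utm s -> utm s' ->
  unif b (fun e => is_subst (x e) (t e) (s e) (s' e)).
Proof. by move=> Hx Ht Hs Hs'; rewrite /is_subst; u_solve. Qed.

#[local] Hint Extern 0 (unif _ (fun _ => is_subst _ _ _ _)) => (apply u_is_subst; u_tm) : unif.

Lemma u_computes b x y z : utm x -> utm y -> utm z ->
  unif b (fun e => computes (x e) (y e) (z e)).
Proof. by move=> Hx Hy Hz; rewrite /computes; u_solve. Qed.

#[local] Hint Extern 0 (unif _ (fun _ => computes _ _ _)) => (apply u_computes; u_tm) : unif.

Lemma u_is_logical_axiom b y : utm y -> unif b (fun e => is_logical_axiom (y e)).
Proof. by move=> Hy; rewrite /is_logical_axiom; u_solve. Qed.

#[local] Hint Extern 0 (unif _ (fun _ => is_logical_axiom _)) => (apply u_is_logical_axiom; u_tm) : unif.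

Lemma u_is_PA_axiom b y : utm y -> unif b (fun e => is_PA_axiom (y e)).
Proof.
move=> Hy; rewrite /is_PA_axiom; elim: PA_basic => [|A l IH] /=.
  by u_solve.
by apply: u_or IH; apply: u_eq => //; apply: utm_num.
Qed.

#[local] Hint Extern 0 (unif _ (fun _ => is_PA_axiom _)) => (apply u_is_PA_axiom; u_tm) : unif.

Lemma u_le_Sigma b l x y : utm l -> utm x -> utm y ->
  unif b (fun e => le_Sigma (l e) (x e) (y e)).
Proof. by move=> Hl Hx Hy; rewrite /le_Sigma /in_W; u_solve. Qed.

#[local] Hint Extern 0 (unif _ (fun _ => le_Sigma _ _ _)) => (apply u_le_Sigma; u_tm) : unif.

Lemma u_is_reflection_instance b g z y : utm g -> utm z -> utm y ->
  unif b (fun e => is_reflection_instance (g e) (z e) (y e)).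
Proof. by move=> Hg Hz Hy; rewrite /is_reflection_instance; u_solve. Qed.

#[local] Hint Extern 0 (unif _ (fun _ => is_reflection_instance _ _ _)) => (apply u_is_reflection_instance; u_tm) : unif.

Lemma u_Prv b (ax : (nat -> term) -> term -> fm) t :
  unif b (fun e => ax (fun i => e i.+1) (e 0)) -> utm t ->
  unif b (fun e => Prv (ax e) (t e)).
Proof. by move=> Hax Ht; rewrite /Prv; u_solve. Qed.

Lemma u_Prv_dot b (ax : (nat -> term) -> term -> fm) f v :
  unif b (fun e => ax (fun i => e i.+1) (e 0)) -> utm f -> utm v ->
  unif b (fun e => Prv_dot (ax e) (f e) (v e)).
Proof.
move=> Hax Hf Hv; rewrite /Prv_dot; u_solve.
by apply: (@u_Prv b (fun e => ax (fun i => e i.+2))); [u_solve|apply: utm_var].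
Qed.

(** [Ax_step] for PA, with the numeral of the order replaced by a term. *)
Definition step_fm (l u x y : term) : fm :=
  fand (dom_Sigma l x) (for_ (is_PA_axiom y)
   (EX z nu g, lt_Sigma l z x /\
     is_num u nu /\ is_subst (num 3) nu u g /\ is_reflection_instance g z y)%F).

Lemma u_step_fm b l u x y : utm l -> utm u -> utm x -> utm y ->
  unif b (fun e => step_fm (l e) (u e) (x e) (y e)).
Proof.
by move=> Hl Hu Hx Hy; rewrite /step_fm /dom_Sigma /lt_Sigma; u_solve.
Qed.

Lemma u_LO l : utm l -> unif false (fun e => LO (l e)).
Proof. by move=> Hl; rewrite /LO /dom_Sigma /in_W; u_solve. Qed.

(** * Computable orders *)

(** All that matters about the evaluation of recursive functions: whether x precedes y in the
    order l is a Sigma_1 relation of the numbers l, x, y, independent of how they are given. *)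
Lemma le_Sigma_value : exists2 R, Sg 1 R &
  forall w e v, (forall i, Den w (e i) (v i)) -> Sem w (le_Sigma (e 0) (e 1) (e 2)) (R v).
Proof. by apply: unif_Sem; apply: u_le_Sigma; apply: utm_var. Qed.

Definition list_env (A : Type) (d : A) (s : seq A) : nat -> A := fun i => nth d s i.

Lemma Den_list w (s : seq term) (l : seq nat) :
  (forall i, i < size s -> Den w (nth Zero s i) (nth 0 l i)) -> size l <= size s ->
  forall i, Den w (list_env Zero s i) (list_env 0 l i).
Proof.
move=> H Hl i; rewrite /list_env; case: (ltnP i (size s)) => Hi; first exact: H.
by rewrite !nth_default //; apply: leq_trans Hl Hi.
Qed.

Lemma Sem_le_Sigma w l x y L m n : Den w l L -> Den w x m -> Den w y n ->
  Sem w (le_Sigma l x y) (order_le L m n).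
Proof.
move=> Hl Hx Hy; have [R _ HR] := le_Sigma_value.
have H := HR w (list_env Zero [:: l; x; y]) (list_env 0 [:: L; m; n]).
apply: (@Sem_iff _ _ (R (list_env 0 [:: L; m; n]))); last first.
  by apply: H; apply: Den_list => // -[|[|[|]]].
have H' rho : Sem (0, rho) (le_Sigma (num L) (num m) (num n)) (R (list_env 0 [:: L; m; n])).
  apply: (HR _ (list_env Zero [:: num L; num m; num n])).
  by apply: Den_list => // -[|[|[|]]] // _; apply: Den_num.
by split=> [HR' rho|HT]; [apply/(H' rho)|apply/(H' (fun _ => 0)); apply: HT].
Qed.

#[local] Hint Extern 0 (Sem _ (le_Sigma _ _ _) _) => (apply Sem_le_Sigma; den) : sem.

Lemma Sem_dom_Sigma w l x L m : Den w l L -> Den w x m ->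
  Sem w (dom_Sigma l x) (order_dom L m).
Proof. by move=> Hl Hx; rewrite /dom_Sigma /order_dom; apply: Sem_le_Sigma. Qed.

#[local] Hint Extern 0 (Sem _ (dom_Sigma _ _) _) => (apply Sem_dom_Sigma; den) : sem.

Lemma Sg_order_le : Sg 1 (fun v => order_le (v 0) (v 1) (v 2)).
Proof.
have [R HR H] := le_Sigma_value; apply: Sg_iff HR => v.
have H2 := H (3, v) (fun i => num (v i)) v (fun i => @Den_num (3, v) (v i)).
have H3 : Sem (3, v) (le_Sigma (num (v 0)) (num (v 1)) (num (v 2)))
   (order_le (v 0) (v 1) (v 2)) by apply: Sem_le_Sigma; apply: Den_num.
exact: iff_trans (iff_sym H2) H3.
Qed.

Definition order_lt (L x y : nat) : Prop := order_le L x y /\ x <> y.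

Lemma Sem_lt_Sigma w l x y L m n : Den w l L -> Den w x m -> Den w y n ->
  Sem w (lt_Sigma l x y) (order_lt L m n).
Proof. by move=> Hl Hx Hy; rewrite /lt_Sigma /order_lt; sem. Qed.

#[local] Hint Extern 0 (Sem _ (lt_Sigma _ _ _) _) => (apply Sem_lt_Sigma; den) : sem.

Record linear_order (L : nat) : Prop := LinearOrder {
  lo_dom : forall x y, order_le L x y -> order_dom L x /\ order_dom L y;
  lo_anti : forall x y, order_le L x y -> order_le L y x -> x = y;
  lo_trans : forall x y z, order_le L x y -> order_le L y z -> order_le L x z;
  lo_total : forall x y, order_dom L x -> order_dom L y -> order_le L x y \/ order_le L y x
}.

Lemma PA_verifiable_linear L : PA_verifiable L -> linear_order L.
Proof.
move=> /(prv_true PA_true) /(_ (fun _ => 0)) HT.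
have [w Ew] : exists w : world, w = (0, fun _ => 0) by exists (0, fun _ => 0).
have Hl := @Den_num w L.
have HS : Sem w (LO (num L)) ((sat w.2 ((EX p s, num L =: <<p, s>> /\
      AL z, ~ in_W p z <-> in_W s z)%F w.1)) /\
    (forall x y, order_le L x y -> order_dom L x /\ order_dom L y) /\
    (forall x y, order_le L x y /\ order_le L y x -> x = y) /\
    (forall x y z, order_le L x y /\ order_le L y z -> order_le L x z) /\
    (forall x y, order_dom L x /\ order_dom L y -> order_le L x y \/ order_le L y x)).
  apply: Sem_and; first exact: iff_refl.
  by sem.
rewrite Ew in HS; have [_ [H1 [H2 [H3 H4]]]] := HS.1 HT.
split=> //.
- by move=> x y Hxy Hyx; apply: H2.
- by move=> x y z Hxy Hyz; apply: H3 (conj Hxy Hyz).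
- by move=> x y Hx Hy; apply: H4.
Qed.

(* Unfolding it would unfold the arithmetized evaluation of recursive functions. *)
Global Opaque order_le.

(** * The iterated theories *)

Lemma pair_code_ge x y : x <= pair_code x y /\ y <= pair_code x y.
Proof. have := pair_code_double x y; move: (pair_code x y) => p; split; nia. Qed.

Lemma free_t_code x s : free_t x s -> x <= code_t s.
Proof.
elim: s => [m||s IH|s IHs t IHt|s IHs t IHt] //=; rewrite code_tE.
- by move=> /eqP <-; case: (pair_code_ge 0 m).
- by move=> /IH H; apply: leq_trans H _; case: (pair_code_ge 2 (code_t s)).
- move=> /orP[/IHs|/IHt] H; apply: leq_trans H _;
    have := pair_code_ge 5 (pair_code (code_t s) (code_t t));
    have := pair_code_ge (code_t s) (code_t t); lia.
- move=> /orP[/IHs|/IHt] H; apply: leq_trans H _;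
    have := pair_code_ge 6 (pair_code (code_t s) (code_t t));
    have := pair_code_ge (code_t s) (code_t t); lia.
Qed.

(** This makes the bounded quantifier of [is_reflection_instance] express that v_0 is the
    only free variable. *)
Lemma free_code x A : free x A -> x <= code A.
Proof.
elim: A => [|m A IH|s t|s t|A IHA B IHB] //=; rewrite codeE.
- move=> /andP[_ /IH] H; apply: leq_trans H _;
    have := pair_code_ge 4 (pair_code m (code A)); have := pair_code_ge m (code A); lia.
- move=> /orP[/free_t_code|/free_t_code] H; apply: leq_trans H _;
    have := pair_code_ge 7 (pair_code (code_t s) (code_t t));
    have := pair_code_ge (code_t s) (code_t t); lia.
- move=> /orP[/free_t_code|/free_t_code] H; apply: leq_trans H _;
    have := pair_code_ge 8 (pair_code (code_t s) (code_t t));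
    have := pair_code_ge (code_t s) (code_t t); lia.
- move=> /orP[/IHA|/IHB] H; apply: leq_trans H _;
    have := pair_code_ge 9 (pair_code (code A) (code B));
    have := pair_code_ge (code A) (code B); lia.
Qed.

Lemma Sem_Prv_dot w ax Q f v A n : SemT w ax Q -> Den w f (code A) -> Den w v n ->
  Sem w (Prv_dot ax f v) (prv (fun B => Q (code B)) (subst 0 (num n) A)).
Proof.
move=> Hax Hf Hv.
apply: (@Sem_iff _ _ (exists c m, c = code_t (num n) /\
   Ind (subst_rule 0 c) (pair_code (code A) m) /\
   exists B, m = code B /\ prv (fun B => Q (code B)) B)).
  split.
    move=> [c [m [-> [/Ind_subst_form [_ ->] [B [/code_inj <- HB]]]]]] //.
  move=> H; exists (code_t (num n)), (code (subst 0 (num n) A)); split=> //; split.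
    by apply/Ind_subst_form; split=> //; apply: substitutable_num.
  by exists (subst 0 (num n) A).
rewrite /Prv_dot; sem.
by apply: Sem_Prv.
Qed.

Definition refl_code (g z y : nat) : Prop :=
  exists a nz na g' h, form_code a /\
    (forall x, x <= a -> x = 0 \/ Ind (fresh_rule x) a) /\
    nz = code_t (num z) /\ Ind (subst_rule 2 nz) (pair_code g g') /\
    na = code_t (num a) /\ Ind (subst_rule 1 na) (pair_code g' h) /\
    y = pair_code 4 (pair_code 0 (pair_code 9 (pair_code h a))).

Lemma Sem_is_reflection_instance w g z y mg mz my :
  Den w g mg -> Den w z mz -> Den w y my ->
  Sem w (is_reflection_instance g z y) (refl_code mg mz my).
Proof.
by move=> Hg Hz Hy; rewrite /is_reflection_instance /refl_code; sem.
Qed.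

#[local] Hint Extern 0 (Sem _ (is_reflection_instance _ _ _) _) => (apply Sem_is_reflection_instance; den) : sem.

Definition only_v0 (A : form) : Prop := forall x, free x A -> x = 0.

(** [premise D z A] says that A(v_0) is provable in the theory of index z, when
    [D] is the formula whose diagonalization defines these theories. *)
Definition premise (D : form) (z : nat) (A : form) : form :=
  subst 1 (num (code A)) (subst 2 (num z) (subst 3 (num (code D)) D)).

Definition refl_axiom (D : form) (z : nat) (A : form) : form :=
  All 0 (Imp (premise D z A) A).

Definition refl_axiom_code (D : form) (z y : nat) : Prop :=
  exists2 A, only_v0 A & y = code (refl_axiom D z A).

Lemma refl_codeP D z y :
  refl_code (code (subst 3 (num (code D)) D)) z y <-> refl_axiom_code D z y.
Proof.
split=> [[a [nz [na [g [h]]]]]|[A HA ->]].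
  move=> [[A ->] [HA [-> [/Ind_subst_form [_ ->] [-> [/Ind_subst_form [_ ->] ->]]]]]].
  exists A; last by rewrite /refl_axiom !codeE.
  move=> x Hx; case: (HA x (free_code Hx)) => // /Ind_fresh_form.
  by rewrite Hx.
exists (code A), (code_t (num z)), (code_t (num (code A))).
exists (code (subst 2 (num z) (subst 3 (num (code D)) D))), (code (premise D z A)).
split; first by exists A.
split.
  move=> x _; case Hx: (free x A); first by left; apply: HA.
  by right; apply/Ind_fresh_form; rewrite Hx.
split=> //; split; first by apply/Ind_subst_form; split=> //; apply: substitutable_num.
split=> //; split; first by apply/Ind_subst_form; split=> //; apply: substitutable_num.
by rewrite /refl_axiom !codeE.
Qed.

Definition PA_code (n : nat) : Prop := exists A, PA A /\ n = code A.

(** Reflection for all theories whose index z satisfies [R z], where u has the code of the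
    formula [D] of [premise] as its value. *)
Definition reflected (R : term -> fm) (u y : term) : fm :=
  (EX z nu g, R z /\ is_num u nu /\ is_subst (num 3) nu u g /\
     is_reflection_instance g z y)%F.

Definition reflected_code (X : nat -> Prop) (u n : nat) : Prop :=
  exists z nu g, X z /\ nu = code_t (num u) /\
    Ind (subst_rule 3 nu) (pair_code u g) /\ refl_code g z n.

Lemma Sem_reflected w R X u y m n : SemT w R X -> Den w u m -> Den w y n ->
  Sem w (reflected R u y) (reflected_code X m n).
Proof.
by move=> HR Hu Hy; rewrite /reflected /reflected_code; sem.
Qed.

Lemma reflected_codeP X D n :
  reflected_code X (code D) n <-> exists z, X z /\ refl_axiom_code D z n.
Proof.
split.
  move=> [z [nu [g [Hz [-> [/Ind_subst_form [_ ->] /refl_codeP H]]]]]].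
  by exists z.
move=> [z [Hz /refl_codeP H]].
exists z, (code_t (num (code D))), (code (subst 3 (num (code D)) D)).
split=> //; split=> //; split=> //.
by apply/Ind_subst_form; split=> //; apply: substitutable_num.
Qed.

Definition diag (L : nat) : form := diag_form L is_PA_axiom.

Definition iter_axiom (L x n : nat) : Prop :=
  order_dom L x /\ (PA_code n \/ exists z, order_lt L z x /\ refl_axiom_code (diag L) z n).

(** Reflection for the indices up to a, with a included: when a is the last element of L,
    no theory RFN^(L,b)(PA) has all these axioms. *)
Definition upto_axiom (L x n : nat) : Prop :=
  PA_code n \/ exists z, order_le L z x /\ refl_axiom_code (diag L) z n.

Definition upto_fm (l u x y : term) : fm :=
  for_ (is_PA_axiom y) (reflected (fun z => le_Sigma l z x) u y).

Lemma Sem_Ax_step w L u x y m n : Den w u (code (diag L)) -> Den w x m -> Den w y n ->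
  Sem w (Ax_step L is_PA_axiom u x y) (iter_axiom L m n).
Proof.
move=> Hu Hx Hy; have Hl := @Den_num w L.
apply: Sem_and; first by sem.
apply: Sem_or; first exact: Sem_is_PA_axiom.
apply: Sem_iff (reflected_codeP _ _ _) _.
apply: (@Sem_reflected w (fun z => lt_Sigma (num L) z x)) => // w' t k Hw Ht; lift Hw.
by sem.
Qed.

Definition upto_code (L u x n : nat) : Prop :=
  PA_code n \/ reflected_code (fun z => order_le L z x) u n.

Lemma upto_codeP L x n : upto_code L (code (diag L)) x n <-> upto_axiom L x n.
Proof. by rewrite /upto_code reflected_codeP. Qed.

Lemma Sem_upto w l u x y L k m n : Den w l L -> Den w u k -> Den w x m ->
  Den w y n -> Sem w (upto_fm l u x y) (upto_code L k m n).
Proof.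
move=> Hl Hu Hx Hy; apply: Sem_or; first exact: Sem_is_PA_axiom.
by apply: Sem_reflected => // w' t i Hw Ht; lift Hw; sem.
Qed.

Lemma axioms_of_PA A : axioms_of is_PA_axiom A <-> PA A.
Proof.
have H rho := @Sem_is_PA_axiom (0, rho) _ _ (@Den_num (0, rho) (code A)).
split=> [HT|HA rho].
  by have [B [HB /code_inj ->]] := (H (fun _ => 0)).1 (HT _).
by apply: (H rho).2; exists A.
Qed.

Lemma axioms_of_iter L z A :
  axioms_of (Ax_iter L is_PA_axiom (num z)) A <-> iter_axiom L z (code A).
Proof.
have H rho : Sem (0, rho) (Ax_iter L is_PA_axiom (num z) (num (code A)))
    (iter_axiom L z (code A)) by apply: Sem_Ax_step; apply: Den_num.
split=> [HT|HA rho]; first exact: (H (fun _ => 0)).1 (HT _).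
exact: (H rho).2.
Qed.

(** ** Soundness *)

Lemma sat_premise rho D z A : sat rho (premise D z A) <->
  sat (upd (upd (upd rho 1 (code A)) 2 z) 3 (code D)) D.
Proof. by rewrite /premise !sat_subst_num. Qed.

(** If the premise holds for n, then A(n) is provable from true axioms, hence true. *)
Lemma refl_axiom_true L z A : only_v0 A ->
  (forall B, iter_axiom L z (code B) -> true_in_N B) -> true_in_N (refl_axiom (diag L) z A).
Proof.
move=> HA HT rho n.
change (sat (upd rho 0 n) (premise (diag L) z A) -> sat (upd rho 0 n) A).
rewrite sat_premise; set rho1 := upd _ 3 _ => HD.
have HS : Sem (4, rho1) (Prv_dot (Ax_step L is_PA_axiom (Var 3) (Var 2)) (Var 1) (Var 0))
    (prv (fun B => iter_axiom L z (code B)) (subst 0 (num n) A)).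
  apply: Sem_Prv_dot; try exact: (@Den_var 4 rho1).
  move=> w t k Hw Ht; apply: Sem_Ax_step => //; apply: Den_extends Hw _; exact: (@Den_var 4 rho1).
by have := prv_true HT (HS.1 HD) rho; rewrite sat_subst_num.
Qed.

Lemma PA_code_true A : PA_code (code A) -> true_in_N A.
Proof. by case=> B [HB /code_inj ->]; apply: PA_true. Qed.

Lemma iter_axiom_true L x : Acc (order_lt L) x ->
  forall B, iter_axiom L x (code B) -> true_in_N B.
Proof.
elim=> {}x _ IH B [_ [/PA_code_true//|[z [Hz [A HA /code_inj ->]]]]].
by apply: refl_axiom_true => //; apply: IH.
Qed.

Lemma upto_axiom_true L x : (forall z, order_le L z x -> Acc (order_lt L) z) ->
  forall B, upto_axiom L x (code B) -> true_in_N B.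
Proof.
move=> Hacc B [/PA_code_true//|[z [Hz [A HA /code_inj ->]]]].
by apply: refl_axiom_true => //; apply: iter_axiom_true; apply: Hacc.
Qed.

(** ** Uniformity in the order *)

(** The instances of this family include the diagonalized formula as well as the premise of
    each reflection axiom, with variables or numerals as arguments. *)
Definition dot_family (e : nat -> term) : fm :=
  Prv_dot (step_fm (e 0) (e 1) (e 2)) (e 3) (e 4).

Lemma u_dot_family b : unif b dot_family.
Proof.
apply: u_Prv_dot; try exact: utm_var.
by apply: u_step_fm; apply: utm_var.
Qed.

(** Substituting the numerals step by step gives back the formula that defines the theory
    of index z, since the free variables v_1, v_2, v_3 are only arguments of the family. *)
Lemma premiseE L z A :
  premise (diag L) z A =
  Prv_dot (Ax_iter L is_PA_axiom (num z)) (num (code A)) (Var 0) 4.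
Proof.
have [h H] := unif_subst (u_dot_family true).
pose e := list_env Zero [:: num L; Var 3; Var 2; Var 1; Var 0].
have -> : premise (diag L) z A = subst 1 (num (code A)) (subst 2 (num z)
  (subst 3 (num (code (diag L))) (dot_family e 4))) by [].
rewrite !H; try by left.
pose e' := list_env Zero [:: num L; num (code (diag L)); num z; num (code A); Var 0].
have -> : (fun i => subst_t 1 (num (code A)) (subst_t 2 (num z)
             (subst_t 3 (num (code (diag L))) (e i)))) = e'.
  apply: functional_extensionality => -[|[|[|[|[|i]]]]];
    by rewrite /e /e' /list_env /= ?nth_nil ?subst_t_num.
by [].
Qed.

Lemma refl_axiomE L z A :
  refl_axiom (diag L) z A = reflection_instance (Ax_iter L is_PA_axiom (num z)) A.
Proof. by rewrite /refl_axiom premiseE. Qed.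

(** The placeholder x for the numeral of L is chosen beyond all bound variables, which
    cannot capture it there and do not depend on L. *)
Lemma diag_uniform : exists x A, forall L, diag L = subst x (num L) A.
Proof.
have [h H] := unif_subst (u_dot_family true).
pose e t := list_env Zero [:: t; Var 3; Var 2; Var 1; Var 0].
exists (4 + h).+1, (dot_family (e (Var (4 + h).+1)) 4) => L.
rewrite H; last by right; lia.
suff -> : (fun i => subst_t (4 + h).+1 (num L) (e (Var (4 + h).+1) i)) = e (num L) by [].
apply: functional_extensionality => -[|[|[|[|[|i]]]]];
  by rewrite /e /list_env /= ?nth_nil ?eqxx.
Qed.

Lemma LO_uniform : exists x A, forall L, LO (num L) 0 = subst x (num L) A.
Proof.
have [h H] := unif_subst (u_LO (utm_var 0)).
exists h, (LO (Var h) 0) => L.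
by rewrite (H h (num L) 0 (fun _ => Var h)) /= ?eqxx //; right.
Qed.

(** * Order types below powers of omega *)

(** In a linear order of well-ordered type this says that the interval [x,y] has type
    below omega^(m+1).  For m = 0 the interval is finite, that is, bounded as a set of
    numbers.  For larger m, each z in it is the end of an interval [w,z] of type below
    omega^m, where w ranges over a finite, hence bounded, set.  The quantifier over w
    merges with the next one over b, so there are m+1 alternations from exists to forall. *)
Fixpoint near (L m x y : nat) : Prop :=
  match m with
  | 0 => exists b, forall z, order_le L x z -> order_le L z y -> z <= b
  | m'.+1 => exists b, forall z, order_le L x z -> order_le L z y ->
      exists w, w <= b /\ order_le L w z /\ near L m' w z
  end.

Lemma lo_refl_l L x y : linear_order L -> order_le L x y -> order_le L x x.
Proof. by move=> H /(lo_dom H) []. Qed.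

Lemma lo_refl_r L x y : linear_order L -> order_le L x y -> order_le L y y.
Proof. by move=> H /(lo_dom H) []. Qed.

Lemma lo_le_lt_trans L x y z : linear_order L ->
  order_le L x y -> order_lt L y z -> order_lt L x z.
Proof.
move=> H Hxy [Hyz Hne]; split; first exact: (lo_trans H) Hxy Hyz.
by move=> E; subst z; apply: Hne; apply: (lo_anti H).
Qed.

Lemma lo_lt_le_trans L x y z : linear_order L ->
  order_lt L x y -> order_le L y z -> order_lt L x z.
Proof.
move=> H [Hxy Hne] Hyz; split; first exact: (lo_trans H) Hxy Hyz.
by move=> E; subst z; apply: Hne; apply: (lo_anti H).
Qed.

(** An inaccessible z in [x,y] has some w <= b with G w z.  By hypothesis some u below w is
    then inaccessible; it lies in [x,y] as well and has its own w' <= b, which is below w.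
    So there would be an infinite descent among the finitely many numbers up to b.  The
    relation G is arbitrary in order to treat both cases of [near]. *)
Lemma cover_acc L (G : nat -> nat -> Prop) x y b : linear_order L ->
  (forall w z, G w z -> order_le L w z ->
     (forall u, order_lt L u w -> Acc (order_lt L) u) -> Acc (order_lt L) z) ->
  (forall z, order_le L x z -> order_le L z y ->
     exists w, w <= b /\ order_le L w z /\ G w z) ->
  (forall u, order_lt L u x -> Acc (order_lt L) u) ->
  forall z, order_le L x z -> order_le L z y -> Acc (order_lt L) z.
Proof.
move=> HL HG Hcov Hx z0 Hxz0 Hz0y; apply: NNPP => Hbad.
suff desc k : exists s w z, [/\ size s = k, uniq s & forall v, v \in s -> v <= b /\ order_lt L w v] /\
    [/\ w <= b, order_le L w z & G w z] /\
    [/\ order_le L x z, order_le L z y & ~ Acc (order_lt L) z].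
  have [s [w [z [[Hs Hu Hb] _]]]] := desc b.+2.
  have : size s <= size (iota 0 b.+1).
    by apply: uniq_leq_size => // v /Hb [Hv _]; rewrite mem_iota /= add0n ltnS.
  by rewrite Hs size_iota ltnn.
elim: k => [|k [s [w [z [[Hs Hu Hb] [[Hw Hwz HGw] [Hxz Hzy Hz]]]]]]].
  have [w [Hw [Hwz HGw]]] := Hcov z0 Hxz0 Hz0y.
  by exists [::], w, z0.
have [u [Huw Hacc]] : exists u, order_lt L u w /\ ~ Acc (order_lt L) u.
  apply: NNPP => K; apply: Hz; apply: HG HGw Hwz _ => u Hu'.
  by apply: NNPP => Hacc; apply: K; exists u.
have Huy : order_le L u y by apply: (lo_trans HL) Hzy; apply: (lo_trans HL) Huw.1 Hwz.
have Hxu : order_le L x u.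
  have [//|Hux] := lo_total HL (lo_refl_l HL Hxz) (lo_refl_l HL Huy).
  case: (classic (u = x)) => [<-|Hne]; first exact: lo_refl_l Hux.
  by case: Hacc; apply: Hx.
have [w' [Hw' [Hwu HGw']]] := Hcov u Hxu Huy.
have Hww : order_lt L w' w by apply: lo_le_lt_trans Hwu Huw.
exists (w :: s), w', u; split; last by split.
split; first by rewrite /= Hs.
  by rewrite /= Hu andbT; apply/negP => /Hb [_ []].
move=> v; rewrite inE => /orP[/eqP ->//|/Hb [Hv Hwv]]; split=> //.
exact: lo_lt_le_trans Hww Hwv.1.
Qed.

Lemma near_acc L m x y : linear_order L -> near L m x y ->
  (forall u, order_lt L u x -> Acc (order_lt L) u) ->
  forall z, order_le L x z -> order_le L z y -> Acc (order_lt L) z.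
Proof.
move=> HL; elim: m x y => [|m IH] x y [b Hb] Hx.
  apply: (@cover_acc L (fun w z => w = z) x y b HL _ _ Hx) => [w z <- _|z Hxz Hzy].
    exact: Acc_intro.
  by exists z; split; [exact: Hb|split=> //; apply: lo_refl_l Hzy].
apply: (@cover_acc L (near L m) x y b HL _ Hb Hx) => w z Hwz Hle Hw.
by apply: (IH _ _ Hwz Hw _ Hle); apply: (lo_refl_r HL Hle).
Qed.

(** Measures the elements up to a from the least element x.  The second case covers the
    empty order, which has no index a but still proves the theorems of PA. *)
Definition short (L m a : nat) : Prop :=
  (exists x, order_le L x a /\ near L m x a /\ forall z, ~ order_lt L z x) \/
  (forall z, ~ order_le L z a).

Lemma short_acc L m a : linear_order L -> short L m a ->
  forall z, order_le L z a -> Acc (order_lt L) z.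
Proof.
move=> HL [[x [Hxa [Hnear Hmin]]]|He] z Hza; last by case: (He z).
have Hbelow u : order_lt L u x -> Acc (order_lt L) u by move/Hmin.
apply: (near_acc HL Hnear Hbelow _ Hza).
have [//|Hzx] := lo_total HL (lo_refl_l HL Hxa) (lo_refl_l HL Hza).
case: (classic (z = x)) => [<-|Hne]; first exact: lo_refl_l Hzx.
by case: (Hmin z).
Qed.

Fixpoint lexle (s t : seq nat) : bool :=
  match s, t with
  | [::], _ => true
  | _ :: _, [::] => false
  | x :: s', y :: t' => (x < y) || (x == y) && lexle s' t'
  end.

Lemma tuplelexi_le n (s t : n.-tuplelexi nat) : (s <= t)%O = lexle s t.
Proof.
case: s t => [s Hs] [t Ht]; change ((s <= t :> seqlexi nat)%O = lexle s t).
elim: s t {Hs Ht} => [|x s IH] [|y t] //=.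
rewrite Order.SeqLexiOrder.Exports.lexi_cons IH !leEnat.
by case: ltngtP.
Qed.

Lemma lexle_zero n t : size t = n -> lexle (nseq n 0) t.
Proof. by elim: n t => [|n IH] [|[|y] t] //= [/IH ->]. Qed.

Lemma lexle_between k s u t : size s = size t -> size u = size t ->
  lexle s u -> lexle u t -> take k s = take k t -> take k u = take k t.
Proof.
elim: k s u t => [|k IH] [|x s] [|z u] [|y t] //=.
move=> [Hs] [Hu] Hsu Hut [Exy Est]; subst y.
move: Hsu Hut; case: ltngtP => //= <- Hsu Hut.
by rewrite (IH s u t).
Qed.

Lemma lexle_nth k u t : k < size t -> size u = size t -> take k u = take k t ->
  lexle u t -> nth 0 u k <= nth 0 t k.
Proof.
elim: k u t => [|k IH] [|z u] [|y t] //=.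
  by move=> _ _ _ /orP[/ltnW|/andP[/eqP ->]].
move=> Hk [Hu] [-> E]; rewrite ltnn eqxx /=; exact: IH.
Qed.

(** The least sequence with the first k entries of t followed by j. *)
Definition corner n (k j : nat) (t : seq nat) : seq nat :=
  take k t ++ j :: nseq (n - k.+1) 0.

Lemma size_corner n k j t : k < n -> size t = n -> size (corner n k j t) = n.
Proof. by move=> Hk Ht; rewrite size_cat size_take Ht Hk /= size_nseq; lia. Qed.

Lemma corner_le n k j t : k < n -> size t = n -> j <= nth 0 t k -> lexle (corner n k j t) t.
Proof.
rewrite /corner; elim: k n t => [|k IH] [|n] [|y t] //= Hk [Ht] Hj.
  rewrite subSS subn0; case: ltngtP Hj => //= _ _.
  exact: lexle_zero.
by rewrite ltnn eqxx /= subSS; apply: IH.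
Qed.

Lemma take_corner n k t : k < n -> size t = n ->
  take k.+1 (corner n k (nth 0 t k) t) = take k.+1 t.
Proof.
move=> Hk Ht; rewrite /corner take_cat size_take Ht Hk ltnNge leqnSn /=.
by rewrite subSnn /= take0 (take_nth 0) ?Ht // -cats1.
Qed.

Section Type_to_near.
Variables (L n : nat) (f : nat -> n.-tuplelexi nat).
Hypothesis HL : linear_order L.
Hypothesis Hf : forall x y, order_dom L x -> order_dom L y ->
  (order_le L x y <-> (f x <= f y)%O).
Hypothesis Hdown : forall x s, order_dom L x -> (s <= f x)%O ->
  exists y, order_dom L y /\ f y = s.

Let F x : seq nat := f x.

Let size_F x : size (F x) = n. Proof. exact: size_tuple. Qed.

Let F_le x y : order_dom L x -> order_dom L y -> order_le L x y <-> lexle (F x) (F y).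
Proof. by move=> Hx Hy; rewrite Hf // tuplelexi_le. Qed.

Let F_inj x y : order_dom L x -> order_dom L y -> F x = F y -> x = y.
Proof.
move=> Hx Hy E; have Hr : lexle (F x) (F x) by apply/(F_le Hx Hx).
by apply: (lo_anti HL); apply/F_le => //; rewrite E in Hr *.
Qed.

Let F_down x s : order_dom L x -> size s = n -> lexle s (F x) ->
  exists y, order_dom L y /\ F y = s.
Proof.
move=> Hx /eqP Hs Hle; have [|y [Hy E]] := Hdown (s := Tuple Hs) Hx.
  by rewrite tuplelexi_le.
by exists y; split=> //; rewrite /F E.
Qed.

(** If x and y agree on their first k coordinates, then the elements of [x,y] are
    classified by their next coordinate, which is bounded by that of y. *)
Let cover k x y : k < n -> order_dom L x -> order_dom L y ->
  take k (F x) = take k (F y) ->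
  exists b, forall z, order_le L x z -> order_le L z y ->
    exists w, w <= b /\ order_le L w z /\ take k.+1 (F w) = take k.+1 (F z).
Proof.
move=> Hk Hx Hy Exy; have HkF u : k < size (F u) by rewrite size_F.
have corner_ex j : j <= nth 0 (F y) k -> exists w, order_dom L w /\ F w = corner n k j (F y).
  by move=> Hj; apply: F_down Hy _ _; [apply: size_corner|apply: corner_le].
have [b Hb] : exists b, forall j, j < (nth 0 (F y) k).+1 ->
    exists w, w <= b /\ order_dom L w /\ F w = corner n k j (F y).
  have : forall j, j < (nth 0 (F y) k).+1 -> exists w, order_dom L w /\ F w = corner n k j (F y).
    by move=> j; rewrite ltnS; apply: corner_ex.
  elim: (nth 0 (F y) k).+1 => [|N IH] H; first by exists 0.
  have [|b Hb] := IH; first by move=> j Hj; apply: H; lia.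
  have [w [Hw Ew]] := H N (ltnSn N).
  exists (b + w) => j; rewrite ltnS leq_eqVlt => /orP[/eqP ->|/Hb [w' [Hb' Hw']]].
    by exists w; split; [lia|].
  by exists w'; split; [lia|].
exists b => z Hxz Hzy; have Hz := lo_refl_l HL Hzy.
have Ez : take k (F z) = take k (F y).
  by apply: lexle_between Exy; rewrite ?size_F //; apply/F_le.
have Hj : nth 0 (F z) k <= nth 0 (F y) k.
  by apply: lexle_nth => //; rewrite ?size_F //; apply/F_le.
have [w [Hw [Hdw Ew]]] := Hb _ Hj.
have Ew' : F w = corner n k (nth 0 (F z) k) (F z) by rewrite Ew /corner Ez.
exists w; split=> //; split; last by rewrite Ew' take_corner.
by apply/F_le => //; rewrite Ew'; apply: corner_le.
Qed.

(** Elements that agree except on their last m+1 coordinates are at a distance below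
    omega^(m+1). *)
Lemma near_of_type m x y : m < n -> order_dom L x -> order_dom L y ->
  take (n - m.+1) (F x) = take (n - m.+1) (F y) -> near L m x y.
Proof.
elim: m x y => [|m IH] x y Hm Hx Hy Exy; have Hk : n - _.+1 < n := rev_ord_proof (Ordinal Hm).
  have [b Hb] := cover Hk Hx Hy Exy; exists b => z Hxz Hzy.
  have [w [Hw [Hwz E]]] := Hb z Hxz Hzy; suff <- : w = z by [].
  have En : (n - 0.+1).+1 = n by lia.
  apply: F_inj; [exact: lo_refl_l Hwz|exact: lo_refl_l Hzy|].
  by move: E; rewrite [(_ - _).+1]En !take_oversize ?size_F.
have [b Hb] := cover Hk Hx Hy Exy; exists b => z Hxz Hzy.
have [w [Hw [Hwz E]]] := Hb z Hxz Hzy; exists w; do 2!split=> //.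
have En : (n - m.+2).+1 = n - m.+1 by lia.
by apply: IH; [lia|exact: lo_refl_l Hwz|exact: lo_refl_l Hzy|rewrite -En].
Qed.

Lemma near_minimum a : 0 < n -> order_dom L a ->
  exists x, order_le L x a /\ near L n.-1 x a /\ forall z, ~ order_lt L z x.
Proof.
move=> Hn Ha; have [x [Hx Ex]] := F_down Ha (size_nseq n 0) (lexle_zero (size_F a)).
exists x; split; first by apply/F_le => //; rewrite Ex; apply: lexle_zero.
split.
  by apply: near_of_type => //; [lia|rewrite prednK // subnn !take0].
move=> z [Hzx Hne]; apply: Hne; apply: (lo_anti HL) => //.
have Hz := lo_refl_l HL Hzx.
by apply/F_le => //; rewrite Ex; apply: lexle_zero.
Qed.

End Type_to_near.

Lemma Sg_le i j k : Sg 1 (fun v => order_le (v i) (v j) (v k)).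
Proof.
exact: (Sg_ren (fun n => match n with 0 => i | 1 => j | _ => k end) Sg_order_le).
Qed.

Lemma not_imp2 (A B C : Prop) : A /\ B /\ ~ C <-> ~ (A -> B -> C).
Proof. by case: (classic A); case: (classic B); case: (classic C); tauto. Qed.

Lemma Sg_near m : Sg (2 * m.+1) (fun v => near (v 0) m (v 1) (v 2)).
Proof.
elim: m => [|m IH].
  apply: (@Sg_ex 1 (fun b v => forall z, order_le (v 0) (v 1) z ->
    order_le (v 0) z (v 2) -> z <= b)).
  apply: (@Sg_all 0 (fun z v => order_le (v 1) (v 2) z -> order_le (v 1) z (v 3) -> z <= v 0)).
  apply: Sg_iff (fun v => not_imp2 _ _ _) _.
  apply: (Sg_and (Sg_le 2 3 0)); apply: (Sg_and (Sg_le 2 0 4)).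
  exact/Sg1_atom/D0_not/(D0_le_term (Var 0) (Var 1)).
have [k Ek] : exists k, 2 * m.+1 = k.+1 by exists (2 * m).+1; lia.
have -> : 2 * m.+2 = k.+3 by lia.
rewrite Ek in IH.
apply: (@Sg_ex _ (fun b v => forall z, order_le (v 0) (v 1) z -> order_le (v 0) z (v 2) ->
  exists w, w <= b /\ order_le (v 0) w z /\ near (v 0) m w z)).
apply: (@Sg_all _ (fun z v => order_le (v 1) (v 2) z -> order_le (v 1) z (v 3) ->
  exists w, w <= v 0 /\ order_le (v 1) w z /\ near (v 1) m w z)).
apply: Sg_iff (fun v => not_imp2 _ _ _) _.
apply: Sg_and; first exact: Sg_leq (Sg_le 2 3 0).
apply: Sg_and; first exact: Sg_leq (Sg_le 2 0 4).
suff H : Sg k.+1 (fun v => exists w, w <= v 1 /\ order_le (v 2) w (v 0) /\ near (v 2) m w (v 0)).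
  exact: (Sg_cumul H).2.
apply: (@Sg_ex k (fun w v => w <= v 1 /\ order_le (v 2) w (v 0) /\ near (v 2) m w (v 0))).
apply: Sg_and; first exact/(@Sg_leq 1)/Sg1_atom/(D0_le_term (Var 0) (Var 2)).
apply: Sg_and; first exact: Sg_leq (Sg_le 3 0 1).
exact: (Sg_ren (fun n => match n with 0 => 3 | 1 => 0 | _ => 1 end) IH).
Qed.

Lemma Sg_short m : Sg (2 * m.+1) (fun v => short (v 0) m (v 1)).
Proof.
have pi1 (P : nat -> env -> Prop) : Sg 1 (fun v => P (v 0) (fun i => v i.+1)) ->
    Sg (2 * m.+1) (fun v => forall z, ~ P z v).
  move=> HP; apply: (@Sg_leq 2); first by lia.
  by apply: (@Sg_all 0 (fun z v => ~ P z v)); apply: Sg_iff HP => v; rewrite not_notE.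
have [k Ek] : exists k, 2 * m.+1 = k.+1 by exists (2 * m).+1; lia.
rewrite /short; apply: Sg_or; last first.
  exact: (pi1 (fun z v => order_le (v 0) z (v 1)) (Sg_le 1 0 2)).
have Hnear := Sg_near m; rewrite Ek in pi1 Hnear *.
apply: (@Sg_ex k (fun x v => order_le (v 0) x (v 1) /\ near (v 0) m x (v 1) /\
  forall z, ~ order_lt (v 0) z x)).
apply: Sg_and; first exact: (Sg_leq _ (Sg_le 1 0 2)).
apply: Sg_and.
  exact: (Sg_ren (fun i => match i with 0 => 1 | 1 => 0 | _ => 2 end) Hnear).
apply: (pi1 (fun z v => order_lt (v 1) z (v 0))).
apply: (Sg_and (Sg_le 2 0 1)).
exact/Sg1_atom/D0_not/(D0_eq_term (Var 0) (Var 1)).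
Qed.

(** * The provable sentences as a Sigma_2n set *)

(** A single Sigma_1 relation for all orders.  Inside the formula, the codes of [LO] and of
    [diag] are computed from L by substituting its numeral, and the diagonalization of A is
    computed from the code of A. *)
Lemma provable_uniform : exists2 R, Sg 1 R &
  forall L a A, R (list_env 0 [:: L; a; code A]) <->
    PA_verifiable L /\
    prv (fun B => upto_axiom L a (code B)) (subst 0 (num (code A)) A).
Proof.
have [x1 [A1 H1]] := LO_uniform; have [x2 [A2 H2]] := diag_uniform.
pose F (e : nat -> term) : fm := (EX nl lo u nc d,
  is_num (e 0) nl /\ is_subst (num x1) nl (num (code A1)) lo /\ Prv is_PA_axiom lo /\
  is_subst (num x2) nl (num (code A2)) u /\
  is_num (e 2) nc /\ is_subst (num 0) nc (e 2) d /\ Prv (upto_fm (e 0) u (e 1)) d)%F.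
have HF : unif true F.
  rewrite /F; u_solve; first by apply: (@u_Prv true (fun _ => is_PA_axiom)); [u_solve|apply: utm_var].
  apply: (@u_Prv true (fun e => upto_fm (e 5) (e 2) (e 6))); last exact: utm_var.
  by rewrite /upto_fm /reflected; u_solve.
have [R HR HS] := unif_Sem HF; exists R => // L a A.
have [w Ew] : exists w : world, w = (3, list_env 0 [:: L; a; code A]) by eexists.
have D0 : Den w (Var 0) L by rewrite Ew; apply: Den_var.
have D1 : Den w (Var 1) a by rewrite Ew; apply: Den_var.
have D2 : Den w (Var 2) (code A) by rewrite Ew; apply: Den_var.
have H : Sem w (F (list_env Zero [:: Var 0; Var 1; Var 2])) (R (list_env 0 [:: L; a; code A])).
  by apply: HS; apply: Den_list => // -[|[|[|]]].
apply: iff_trans (iff_sym H) _; clear H.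
apply: (@Sem_iff _ _ (exists nl lo u nc d, nl = code_t (num L) /\
  Ind (subst_rule x1 nl) (pair_code (code A1) lo) /\
  (exists B, lo = code B /\ prv (fun B => PA_code (code B)) B) /\
  Ind (subst_rule x2 nl) (pair_code (code A2) u) /\ nc = code_t (num (code A)) /\
  Ind (subst_rule 0 nc) (pair_code (code A) d) /\
  exists B, d = code B /\ prv (fun B => upto_code L u a (code B)) B)).
  split.
    move=> [nl [lo [u [nc [d [-> [/Ind_subst_form [_ ->] [[B [/code_inj EB HB]] H]]]]]]]].
    move: H => [/Ind_subst_form [_ Eu] [-> [/Ind_subst_form [_ ->] [C [/code_inj <- HC]]]]].
    split.
      rewrite /PA_verifiable H1 EB; apply: prv_weaken HB => C' [C'' [HC'' /code_inj ->]] //.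
    by apply: prv_weaken HC => C'; rewrite Eu -H2; apply: (upto_codeP _ _ _).1.
  move=> [HL HA]; exists (code_t (num L)), (code (LO (num L) 0)), (code (diag L)).
  exists (code_t (num (code A))), (code (subst 0 (num (code A)) A)).
  have Hs x n B : Ind (subst_rule x (code_t (num n))) (pair_code (code B) (code (subst x (num n) B))).
    by apply/Ind_subst_form; split=> //; apply: substitutable_num.
  split=> //; split; first by rewrite H1.
  split; first by exists (LO (num L) 0); split=> //; apply: prv_weaken HL => B HB; exists B.
  split; first by rewrite H2.
  split=> //; split=> //; eexists; split; first by [].
  by apply: prv_weaken HA => B; apply: (upto_codeP _ _ _).2.
rewrite /F /list_env /=; sem.
  by apply: Sem_Prv => // w' t k Hw Ht; apply: Sem_is_PA_axiom.
apply: Sem_Prv => // w' t k Hw Ht; lift Hw.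
exact: Sem_upto.
Qed.

Lemma upto_axiom_mono L a b n :
  (forall z, order_le L z a -> order_le L z b) -> upto_axiom L a n -> upto_axiom L b n.
Proof.
by move=> Hab [HP|[z [Hz Hn]]]; [left|right; exists z; split=> //; apply: Hab].
Qed.

(** A derivation uses finitely many axioms, and the largest of their indices serves for
    all of them.  When the order is empty, any number does for a. *)
Lemma prv_RFN_along L A : linear_order L -> prv (RFN_along L is_PA_axiom) A ->
  exists a, (order_dom L a \/ forall z, ~ order_dom L z) /\
    prv (fun B => upto_axiom L a (code B)) A.
Proof.
move=> HL; elim=> {A} [A|A HA|A B _ [a [Ha HA]] _ [b [Hb HB]]|x A _ [a [Ha HA]]].
- have [a0 Ha0] : exists a, order_dom L a \/ forall z, ~ order_dom L z.
    case: (classic (exists a, order_dom L a)) => [[a Ha]|H]; first by exists a; left.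
    by exists 0; right=> z Hz; apply: H; exists z.
  have base : PA A -> exists a, (order_dom L a \/ forall z, ~ order_dom L z) /\
      prv (fun B => upto_axiom L a (code B)) A.
    by move=> HA; exists a0; split=> //; apply: prv_ax; left; exists A.
  case=> [/axioms_of_PA//|[a [Ha [/axioms_of_iter HA|[C [HC ->]]]]]].
    exists a; split; first by left.
    apply: prv_ax; case: HA => _ [HA|[z [[Hz _] HA]]]; first by left.
    by right; exists z.
  exists a; split; first by left.
  rewrite -refl_axiomE; apply: prv_ax; right; exists a; split; first exact: Ha.
  by exists C; [exact: HC|reflexivity].
- case: (classic (exists a, order_dom L a)) => [[a Ha]|H].
    by exists a; split; [left|apply: prv_log].
  by exists 0; split; [right=> z Hz; apply: H; exists z|apply: prv_log].
- have up c d C : (forall z, order_le L z c -> order_le L z d) ->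
      prv (fun B => upto_axiom L c (code B)) C -> prv (fun B => upto_axiom L d (code B)) C.
    by move=> Hcd; apply: prv_weaken => C'; apply: upto_axiom_mono.
  have [Hab|Hba] : (forall z, order_le L z a -> order_le L z b) \/
                   (forall z, order_le L z b -> order_le L z a).
    case: Ha => [Ha|He]; last by left=> z /(lo_refl_l HL) /He.
    case: Hb => [Hb|He]; last by right=> z /(lo_refl_l HL) /He.
    have [Hab|Hba] := lo_total HL Ha Hb; [left|right] => z Hz; exact: (lo_trans HL) Hz _.
  + by exists b; split=> //; apply: prv_mp (up _ _ _ Hab HA) HB.
  + by exists a; split=> //; apply: prv_mp HA (up _ _ _ Hba HB).
- by exists a; split=> //; apply: prv_gen.
Qed.

Lemma type_short L n a : 0 < n -> linear_order L -> order_type_le_omega_pow L n ->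
  order_dom L a \/ (forall z, ~ order_dom L z) -> short L n.-1 a.
Proof.
move=> Hn HL [f [Hf Hdown]] [Ha|He]; last by right=> z /(lo_refl_l HL) /He.
by left; apply: (near_minimum HL Hf Hdown Hn Ha).
Qed.

Lemma free_subst_num x n A y : free y (subst x (num n) A) -> y != x /\ free y A.
Proof.
have free_t_subst t : free_t y (subst_t x (num n) t) -> y != x /\ free_t y t.
  elim: t => [m|//|t IH|s IHs t IHt|s IHs t IHt] //=.
  - by case: eqP => [_|/eqP Hm]; rewrite ?free_num //= => /eqP <-.
  - by move=> /orP[/IHs|/IHt] [-> ->]; rewrite ?orbT.
  - by move=> /orP[/IHs|/IHt] [-> ->]; rewrite ?orbT.
elim: A => [|m B IH|s t|s t|B IHB C IHC] //=.
- case: eqP => [->|_] /= /andP[Hm]; first by move=> HB; rewrite eq_sym Hm.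
  by move=> /IH [-> ->]; rewrite Hm.
- by move=> /orP[/free_t_subst|/free_t_subst] [-> ->]; rewrite ?orbT.
- by move=> /orP[/free_t_subst|/free_t_subst] [-> ->]; rewrite ?orbT.
- by move=> /orP[/IHB|/IHC] [-> ->]; rewrite ?orbT.
Qed.

(** Tarski's argument, for A(x) expressing that x is not in S.  As S is a set of codes of
    formulas, not of their diagonalizations, the diagonalization is computed inside S. *)
Lemma diagonal m (S : nat -> Prop) : Sg m (fun v => S (v 0)) ->
  (forall A, S (code A) -> true_in_N (subst 0 (num (code A)) A)) ->
  exists A, [/\ Pi m (subst 0 (num (code A)) A), sentence (subst 0 (num (code A)) A),
    true_in_N (subst 0 (num (code A)) A) & ~ S (code A)].
Proof.
move=> /Sg_Sigma [B HB EB] Hsound; have [C HC EC] := Sigma_Pi_neg.1 _ _ HB.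
pose s i := if i == 0 then Var 0 else Zero.
have Hs i : below 1 (s i) by rewrite /s; case: eqP => // _ x /= /eqP <-.
pose A := msub s 1 C.
have EA rho : sat rho (subst 0 (num (code A)) A) <-> ~ S (code A).
  by rewrite sat_subst_num {2}/A sat_msub // EC EB.
have HS : ~ S (code A).
  by move=> H; apply: ((EA (fun _ => 0)).1 (Hsound _ H (fun _ => 0)) H).
exists A; split=> //; last by move=> rho; apply/EA.
  by apply: (Sigma_Pi_subst _ _).2; apply: Sigma_Pi_msub.2.
move=> x; apply/negP => /free_subst_num [Hx /free_msub [i]].
rewrite /s; case: eqP => //= _ /eqP E.
by rewrite -E in Hx.
Qed.

Theorem theorem2 (n : nat) (hn : 1 <= n) :
  exists phi : form,
    Pi (2 * n) phi /\ sentence phi /\ true_in_N phi /\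
    forall L : nat,
      PA_verifiable L -> order_type_le_omega_pow L n ->
      ~ prv (RFN_along L is_PA_axiom) phi.
Proof.
have [R HR ER] := provable_uniform.
pose S c := exists L a, short L n.-1 a /\ R (list_env 0 [:: L; a; c]).
have HS : Sg (2 * n) (fun v => S (v 0)).
  have [k Ek] : exists k, 2 * n = k.+1 by exists (2 * n).-1; lia.
  have Hshort := Sg_short n.-1; rewrite prednK // Ek in Hshort *.
  apply: (@Sg_ex k (fun L v => exists a, short L n.-1 a /\ R (list_env 0 [:: L; a; v 0]))).
  apply: (@Sg_ex k (fun a v => short (v 0) n.-1 a /\ R (list_env 0 [:: v 0; a; v 1]))).
  apply: Sg_and.
    exact: (Sg_ren (fun i => match i with 0 => 1 | _ => 0 end) Hshort).
  apply: (Sg_leq (isT : 1 <= k.+1)).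
  have := Sg_subst (list_env Zero [:: Var 1; Var 0; Var 2]) HR.
  apply: Sg_iff => v; suff -> : (fun i => eval v (list_env Zero [:: Var 1; Var 0; Var 2] i)) =
    list_env 0 [:: v 1; v 0; v 2] by [].
  by apply: functional_extensionality => -[|[|[|i]]]; rewrite /list_env /= ?nth_nil.
have Hsound A : S (code A) -> true_in_N (subst 0 (num (code A)) A).
  move=> [L [a [Hshort /ER [HL HA]]]].
  apply: prv_true HA; apply: upto_axiom_true.
  exact: (short_acc (PA_verifiable_linear HL) Hshort).
have [A [HPi Hsent Htrue HnS]] := diagonal HS Hsound.
exists (subst 0 (num (code A)) A); do 3!split=> //.
move=> L HL Htype Hprv; apply: HnS.
have HLO := PA_verifiable_linear HL.
have [a [Ha HA]] := prv_RFN_along HLO Hprv.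
exists L, a; split; first exact: (type_short hn HLO Htype Ha).
by apply/ER.
Qed.
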